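(* For $z\in\mathbb C\cup\{\infty\}$ the transition function $\tilde p_z$ of the representation $T_z$ is given by $$\tilde p_z(\lambda,\nu)=\frac{|z+c_{\lambda\nu}|^2}{|z|^2+n}\cdot\frac{\dim\nu}{(n+1)\dim\lambda},$$ where $n\ge1$, $\lambda\in\mathbb Y_n$, $\nu\in\mathbb Y_{n+1}$, $\lambda\nearrow\nu$, and $c_{\lambda\nu}=c(\nu\setminus\lambda)$ is the content of the box $\nu\setminus\lambda$ (for $z=\infty$ the first factor is understood as $1$).
   Context: $S(n)$ is the group of permutations of $\{1,\dots,n\}$, identified with the stabilizer of $n+1$ in $S(n+1)$; $S(\infty)=\bigcup_n S(n)$; $G=S(\infty)\times S(\infty)$, $G(n)=S(n)\times S(n)$. The canonical projection $p_{n,n+1}:S(n+1)\to S(n)$ removes $n+1$ from its cycle: for $1\le i\le n$, $(p_{n,n+1}(x))(i)=x(i)$ if $x(i)\le n$, and $=x(n+1)$ if $x(i)=n+1$. $H^n=L^2(S(n))$ with respect to the uniform probability measure; $\mathrm{Reg}^n$ is the representation of $G(n)$ in $H^n$, $(\mathrm{Reg}^n(g)f)(x)=f(g_2^{-1}xg_1)$. For $z\in\mathbb C$, $t=|z|^2$, the isometric $G(n)$-equivariant embedding $L_z^n:H^n\to H^{n+1}$ is $(L_z^nf)(x)=z\sqrt{\frac{n+1}{t+n}}f(x)$ for $x\in S(n)$ and $(L_z^nf)(x)=\sqrt{\frac{n+1}{t+n}}f(p_{n,n+1}(x))$ for $x\in S(n+1)\setminus S(n)$; for $z=\infty$, $(L_\infty^nf)(x)=\sqrt{n+1}\,f(x)$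 for $x\in S(n)$ and $0$ otherwise. $T_z$ is the inductive limit of the $\mathrm{Reg}^n$ along the $L_z^n$, acting in the Hilbert completion $H$ of $\bigcup_nH^n$. $\mathbb Y_n$ is the set of Young diagrams with $n$ boxes; $\lambda\nearrow\nu$ means that $\nu$ is obtained from $\lambda$ by adding one box; the content of a box $b=(i,j)$ (row $i$, column $j$) is $c(b)=j-i$; $\pi^\lambda$ is the irreducible representation of $S(n)$ indexed by $\lambda\in\mathbb Y_n$, and $\dim\lambda=\dim\pi^\lambda$. One has $\mathrm{Reg}^n=\bigoplus_{\lambda\in\mathbb Y_n}(\pi^\lambda\times\pi^\lambda)$; $H(\lambda)\subset H^n$ is the subspace of the component $\pi^\lambda\times\pi^\lambda$ and $P(\lambda):H\to H(\lambda)$ is the orthogonal projection. Transition function: for $\lambda\in\mathbb Y_n$, $\nu\in\mathbb Y_{n+1}$, $\lambda\nearrow\nu$, there is an isometric embedding $E(\lambda,\nu):H(\lambda)\to H(\nu)$ commuting with $G(n)$, unique up to a factor of modulus $1$; the operator $P(\nu)L_z^nP(\lambda)$ equals $\alpha_z(\lambda,\nu)E(\lambda,\nu)$ on $H(\lambda)$ for some $\alpha_z(\lambda,\nu)\in\mathbb C$, and $\tilde p_z(\lambda,\nu)=|\alpha_z(\lambda,\nu)|^2$. Equivalently, $\|P(\nu)\xi\|^2=\tilde p_z(\lambda,\nu)\|\xi\|^2$ for all $\xi\in H(\lambda)$. *)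

(* Defs.v *)
From HB Require Import structures.
From mathcomp Require Import all_boot all_order all_algebra all_fingroup.
From mathcomp Require Import mxrepresentation sesquilinear.
From mathcomp Require Import complex mxtens.
From mathcomp Require Import boolp classical_sets reals.

Set Implicit Arguments.
Unset Strict Implicit.
Unset Printing Implicit Defensive.

Import Order.TTheory GRing.Theory Num.Theory.
Local Open Scope ring_scope.

Record diagram (n : nat) := Diagram {
  rows :> seq nat;
  rows_sorted : sorted geq rows;
  rows_gt0 : all (leq 1) rows;
  rows_sum : sumn rows = n }.

(* Boxes are pairs (row, column), both numbered from 0; contents are the same
   as with numbering from 1. *)
Definition in_diagram n (lam : diagram n) (b : nat * nat) : bool :=
  (b.2 < nth 0 lam b.1)%N.

Definition content (b : nat * nat) : int := b.2%:Z - b.1%:Z.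

Definition adds_box n (lam : diagram n) (nu : diagram n.+1) (b : nat * nat) :=
  ~~ in_diagram lam b /\
  forall c, in_diagram nu c = in_diagram lam c || (c == b).

(* The point called n+1 on paper is ord_max : 'I_n.+1.  In MathComp
   (x * y) i = y (x i), whereas on paper (x y)(i) = x(y(i)). *)

Definition Sembed n (x : 'S_n) : 'S_n.+1 := lift_perm ord_max ord_max x.

Definition Sproj_fun n (x : 'S_n.+1) (i : 'I_n) : 'I_n :=
  let j := x (lift ord_max i) in
  odflt i (unlift ord_max (if j == ord_max then x ord_max else j)).

Lemma lift_Sproj_fun n (x : 'S_n.+1) (i : 'I_n) :
  lift ord_max (Sproj_fun x i) =
    let j := x (lift ord_max i) in if j == ord_max then x ord_max else j.
Proof.
rewrite /Sproj_fun /=; case: unliftP => [k -> //|].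
case: ifP => [/eqP xi|/negbT xi] xm; last by rewrite xm eqxx in xi.
by have /eqP := perm_inj (etrans xi (esym xm)); rewrite eq_sym (negPf (neq_lift _ _)).
Qed.

Lemma Sproj_inj n (x : 'S_n.+1) : injective (Sproj_fun x).
Proof.
move=> i j /(congr1 (lift ord_max)); rewrite !lift_Sproj_fun /=.
have lN k : (ord_max == lift ord_max k :> 'I_n.+1) = false.
  exact: negbTE (neq_lift _ _).
case: eqP => [xi|_]; case: eqP => [xj|_].
- by move=> _; apply: (@lift_inj _ ord_max); apply: (@perm_inj _ x); rewrite xi xj.
- by move/perm_inj => e; have := lN j; rewrite -e eqxx.
- by move/perm_inj => e; have := lN i; rewrite e eqxx.
- by move=> /perm_inj /lift_inj.
Qed.

Definition Sproj n (x : 'S_n.+1) : 'S_n := perm (@Sproj_inj n x).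

Lemma SembedK n : cancel (@Sembed n) (@Sproj n).
Proof.
move=> x; apply/permP => i; apply: (@lift_inj _ ord_max).
rewrite permE lift_Sproj_fun /= lift_perm_lift ifF //.
by rewrite eq_sym; exact: negbTE (neq_lift _ _).
Qed.

Section Representations.
Variable R : realType.
Local Notation C := R[i].

Section YoungSymmetrizer.
Variables (n : nat) (lam : diagram n).

(* The boxes of lam are filled with 0, ..., n-1 row after row: the entry k is
   in row [reshape_index lam k] and column [reshape_offset lam k]. *)
Definition row_stab : {set 'S_n} :=
  [set p : 'S_n | [forall k, reshape_index lam (p k) == reshape_index lam k]].
Definition col_stab : {set 'S_n} :=
  [set q : 'S_n | [forall k, reshape_offset lam (q k) == reshape_offset lam k]].

Definition young_symmetrizer : 'rV[C]_#|[set: 'S_n]| :=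
  \sum_(p in row_stab) \sum_(q in col_stab)
    (-1) ^+ odd_perm q *: delta_mx 0 (gring_index [set: 'S_n] (p * q)%g).

Definition specht_mx := cyclic_mx (regular_repr C [set: 'S_n]) young_symmetrizer.

Definition dim_diagram : nat := \rank specht_mx.

(* pi^lam: the submodule of the regular representation generated by the Young
   symmetrizer. *)
Definition specht : mx_representation C [set: 'S_n] dim_diagram :=
  submod_repr (cyclic_mx_module (regular_repr C [set: 'S_n]) young_symmetrizer).

End YoungSymmetrizer.

Definition L2S n := {ffun 'S_n -> C^o}.

Definition l2dot n (f h : L2S n) : C :=
  (n`!%:R)^-1 * \sum_(x : 'S_n) f x * (h x)^*.

(* On paper f(g_2^-1 x g_1); the order of the factors is reversed because of
   the reversed product of permutations. *)
Definition Reg n (g : 'S_n * 'S_n) (f : L2S n) : L2S n :=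
  [ffun x : 'S_n => f (g.1 * x * g.2^-1)%g].

(* H(lam): the functions lying in a copy of pi^lam x pi^lam (the outer tensor
   square) in Reg^n.  MathComp representations act on row vectors on the right,
   which is a left action for the paper's product of permutations. *)
Definition Hcomp n (lam : diagram n) (f : L2S n) : Prop :=
  exists Phi : {linear 'rV[C]_(dim_diagram lam * dim_diagram lam) -> L2S n},
    [/\ injective Phi,
        forall (g : 'S_n * 'S_n) v,
          Phi (v *m tensmx (specht lam g.1) (specht lam g.2)) = Reg g (Phi v)
      & exists v, f = Phi v].

(* z : option C, where None is the point z = infinity.  S(n) consists of the x
   fixing ord_max; on it Sproj is the identity (SembedK), so that f (Sproj x) is
   the paper's f(x). *)
Definition Lz (z : option C) n (f : L2S n) : L2S n.+1 :=
  [ffun x : 'S_n.+1 =>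
    match z with
    | Some w =>
        (if x ord_max == ord_max then w else 1) *
        sqrtC (n.+1%:R / (`|w| ^+ 2 + n%:R)) * f (Sproj x)
    | None =>
        if x ord_max == ord_max then sqrtC n.+1%:R * f (Sproj x) else 0
    end].

(* The inductive limit of the Reg^n, n >= 1, along the Lz: a Hilbert space with
   isometric embeddings of the L^2(S(n)) that are compatible with the Lz and
   have dense union, and a unitary action of S(oo) x S(oo), given by its
   restrictions to the S(n) x S(n), that extends the Reg^n.  It is unique up to
   isomorphism.  Nothing is required for n = 0. *)
Record inductive_limit (z : option C) := InductiveLimit {
  lim_space :> lmodType C;
  lim_dot : {dot lim_space for Num.conj};
  lim_complete : forall u : nat -> lim_space,
    (forall e : C, 0 < e -> exists N, forall k l, (N <= k)%N -> (N <= l)%N ->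
       lim_dot (u k - u l) (u k - u l) < e) ->
    exists a, forall e : C, 0 < e -> exists N, forall k, (N <= k)%N ->
       lim_dot (u k - a) (u k - a) < e;
  lim_emb : forall n, {linear L2S n -> lim_space};
  lim_emb_iso : forall n, (0 < n)%N -> forall f h,
    lim_dot (lim_emb n f) (lim_emb n h) = l2dot f h;
  lim_emb_compat : forall n, (0 < n)%N -> forall f,
    lim_emb n.+1 (Lz z f) = lim_emb n f;
  lim_dense : forall (a : lim_space) (e : C), 0 < e ->
    exists n (f : L2S n), (0 < n)%N /\
      lim_dot (a - lim_emb n f) (a - lim_emb n f) < e;
  lim_act : forall n, 'S_n * 'S_n -> {linear lim_space -> lim_space};
  lim_act_iso : forall n, (0 < n)%N -> forall (g : 'S_n * 'S_n) a b,
    lim_dot (lim_act g a) (lim_act g b) = lim_dot a b;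
  lim_act_compat : forall n, (0 < n)%N -> forall (g : 'S_n * 'S_n) a,
    lim_act (Sembed g.1, Sembed g.2) a = lim_act g a;
  lim_act_emb : forall n, (0 < n)%N -> forall (g : 'S_n * 'S_n) f,
    lim_act g (lim_emb n f) = lim_emb n (Reg g f) }.

Definition orthproj (V : lmodType C) (d : {dot V for Num.conj}) (W : set V)
    (x : V) : V :=
  xget 0 [set y | W y /\ forall w, W w -> d (x - y) w = 0]%classic.

Section Transition.
Variables (z : option C) (T : inductive_limit z).

Definition limcomp n (lam : diagram n) : set T :=
  [set lim_emb T n f | f in Hcomp lam]%classic.

Definition Pcomp n (lam : diagram n) : T -> T :=
  orthproj (lim_dot T) (limcomp lam).

(* E stands for its restriction H(lam) -> H(nu); its values off H(lam) are
   irrelevant. *)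
Definition equivariant_isometry n (lam : diagram n) (nu : diagram n.+1)
    (E : {linear L2S n -> L2S n.+1}) : Prop :=
  forall f, Hcomp lam f ->
    [/\ Hcomp nu (E f),
        l2dot (E f) (E f) = l2dot f f
      & forall g, E (Reg g f) = Reg (Sembed g.1, Sembed g.2) (E f)].

(* p is the value at (lam, nu) of the transition function of T = T_z. *)
Definition transition_value n (lam : diagram n) (nu : diagram n.+1) (p : C) :=
  exists (E : {linear L2S n -> L2S n.+1}) (alpha : C),
    [/\ equivariant_isometry lam nu E,
        forall f, Hcomp lam f ->
          Pcomp nu (lim_emb T n.+1 (Lz z f)) = alpha *: lim_emb T n.+1 (E f)
      & p = `|alpha| ^+ 2].

End Transition.
End Representations.

Arguments dim_diagram R {n} lam.

(* Main.v *)
From HB Require Import structures.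
Require Import Defs.
From mathcomp Require Import all_boot all_order all_algebra all_fingroup.
From mathcomp Require Import mxrepresentation sesquilinear.
From mathcomp Require Import complex mxtens.
From mathcomp Require Import boolp classical_sets reals.
From mathcomp Require Import ring.

Set Implicit Arguments.
Unset Strict Implicit.
Unset Printing Implicit Defensive.

Import Order.TTheory GRing.Theory Num.Theory.
Local Open Scope ring_scope.

(** The operators Lz are right translations in the group algebra. Every x in
    S(n+1) is uniquely y * t with y = Sproj x and t either 1 or a transposition
    (i n+1), so Lz f is, up to the factor s = sqrt ((n + 1) / (|z|^2 + n)), the
    convolution of f, extended by zero, with z + J, where
    J = (1 n+1) + ... + (n n+1) is the Jucys-Murphy element. The space H(lam) is
    the space of matrix coefficients of the Specht module (HcompP), and the
    projection onto H(nu) only depends on the Fourier transform of the function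
    at nu (proj_coef_orth), which turns the convolution with z + J into the
    multiplication by z + rho_nu(J).

    Now pi^lam occurs exactly once in the restriction of pi^nu to S(n), and J
    acts on this copy by the content c of the added box. Hence P(nu) Lz f is
    s (z + c) P(nu) f (fourier_Lz), where z + c is replaced by 1 and s by
    sqrt (n + 1) for z = infinity. The map f |-> P(nu) f is equivariant, and the
    restriction of P(nu) f to S(n) is a known multiple of f, which gives its norm
    (l2dot_res_fourier); dividing by this norm yields E and the coefficient
    alpha. That no other value is possible is clear from the fact that |alpha|^2
    is a ratio of squared norms (transition_value_unique).

    The facts on Specht modules are derived from the Young symmetrizer c = R C,
    the product of the sum over the row group and of the alternating sum over
    the column group.
    - R x C is 0 or c up to sign for every permutation x (young_row_col), and
      c^2 is not 0, by a positivity argument (signed_sums_neq0); so the Specht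
      module c A has only scalar endomorphisms (specht_schur).
    - pi^lam occurs at most once in pi^nu because the centralizer of S(n) in the
      group algebra of S(n+1) is commutative (centralizer_comm), and at least
      once because the Young symmetrizer of lam does not kill the Specht module
      of nu, again by positivity (specht_hom_neq0).
    - 2 J + 1 is the difference between the sums of all (i j), for i and j
      ranging over n + 1 and over n points; these sums are central, and the
      scalars by which they act are read off from the coefficient of the
      identity in c * (i j) (tperm_sum_specht, jucys_murphy_content). *)

(** * Intertwiners and averaging *)
Section Intertwiners.
Variables (F : numFieldType) (gT : finGroupType).
Local Notation rep := (mx_representation F [set: gT]).

Definition intertwines d e (r1 : rep d) (r2 : rep e) (S : 'M[F]_(d, e)) :=
  forall x, r1 x *m S = S *m r2 x.

(** The conclusion of Schur's lemma over an algebraically closed field, which is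
    the form in which irreducibility is used throughout. *)
Definition schur d (r : rep d) :=
  forall X, intertwines r r X -> exists a : F, X = a%:M.

Lemma reprM d (r : rep d) x y : r (x * y)%g = r x *m r y.
Proof. by rewrite repr_mxM ?inE. Qed.

Lemma reprVK d (r : rep d) x : r x *m r x^-1%g = 1%:M.
Proof. by rewrite -reprM mulgV repr_mx1. Qed.

Lemma reprKV d (r : rep d) x : r x^-1%g *m r x = 1%:M.
Proof. by rewrite -reprM mulVg repr_mx1. Qed.

Definition average d e (r1 : rep d) (r2 : rep e) (X : 'M[F]_(d, e)) :=
  \sum_(y : gT) r1 y^-1%g *m X *m r2 y.

Lemma average_intertwines d e (r1 : rep d) (r2 : rep e) X :
  intertwines r1 r2 (average r1 r2 X).
Proof.
move=> x; rewrite mulmx_sumr mulmx_suml.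
rewrite [RHS](reindex_inj (mulIg x^-1%g)) /=; apply: eq_bigr => y _.
by rewrite !mulmxA -reprM invMg invgK -[RHS]mulmxA -reprM mulgKV.
Qed.

Lemma intertwines_mul d e f (r1 : rep d) (r2 : rep e) (r3 : rep f) S T :
  intertwines r1 r2 S -> intertwines r2 r3 T -> intertwines r1 r3 (S *m T).
Proof. by move=> hS hT x; rewrite mulmxA hS -!mulmxA hT. Qed.

(** The product is an endomorphism of r1, hence a scalar, and the scalar is
    found by taking traces. *)
Lemma mul_average_scalar d e (r1 : rep d) (r2 : rep e) S X :
    (0 < d)%N -> schur r1 -> intertwines r1 r2 S ->
  S *m average r2 r1 X = (#|gT|%:R * \tr (S *m X) / d%:R)%:M.
Proof.
move=> d_gt0 sr hS.
have [a Ea] := sr _ (intertwines_mul hS (average_intertwines r2 r1 X)).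
have d_neq0 : d%:R != 0 :> F by rewrite pnatr_eq0 -lt0n.
rewrite Ea; congr (_%:M); apply: (canRL (mulfK d_neq0)).
rewrite mulr_natr -mxtrace_scalar -Ea mulmx_sumr raddf_sum /=.
rewrite (eq_bigr (fun=> \tr (S *m X))) ?sumr_const ?mulr_natl // => y _.
by rewrite !mulmxA -hS -mulmxA -mulmxA mxtrace_mulC -!mulmxA reprVK mulmx1.
Qed.

(** Orthogonality relations, for which it is enough to know the averages of
    matrices: expanding M in matrix units turns the Fourier transform of
    x |-> tr (r1 x M) at r2 into averages of matrix units. *)
Lemma fourier_of_average d e (r1 : rep d) (r2 : rep e) S T (k : F) M :
    (forall X, average r2 r1 X = (k * \tr (S *m X)) *: T) ->
  \sum_(y : gT) \tr (r1 y *m M) *: r2 y^-1%g = k *: (T *m M *m S).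
Proof.
move=> avE; apply/matrixP => i j; rewrite summxE.
transitivity (\sum_u \sum_v M v u * average r2 r1 (delta_mx j u) i v).
  under eq_bigr => y _ do rewrite mxE /mxtrace mulr_suml.
  rewrite exchange_big /=; apply: eq_bigr => u _.
  under eq_bigr => y _ do rewrite mxE mulr_suml.
  rewrite exchange_big /=; apply: eq_bigr => v _.
  rewrite summxE mulr_sumr; apply: eq_bigr => y _.
  rewrite mxE (bigD1 u) //= big1 ?addr0 => [|w wu]; last first.
    rewrite mxE big1 ?mul0r // => w' _; rewrite mxE.
    by rewrite (negPf wu) andbF mulr0.
  rewrite mxE (bigD1 j) //= big1 ?addr0 => [|w wu]; last first.
    by rewrite mxE (negPf wu) mulr0.
  rewrite mxE !eqxx mulr1 -!mulrA.
  by rewrite mulrCA [r1 y u v * _]mulrC.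
rewrite mxE mxE mulr_sumr; apply: eq_bigr => u _.
rewrite mxE mulr_suml mulr_sumr; apply: eq_bigr => v _.
have trS : \tr (S *m delta_mx j u) = S u j.
  rewrite /mxtrace (bigD1 u) //= big1 ?addr0 => [|w wu]; last first.
    rewrite mxE big1 // => w' _; rewrite mxE (negPf wu).
    by rewrite andbF mulr0.
  rewrite mxE (bigD1 j) //= big1 ?addr0 => [|w wu]; last first.
    by rewrite mxE (negPf wu) mulr0.
  by rewrite mxE !eqxx mulr1.
by rewrite avE mxE trS; ring.
Qed.

Lemma schur_orthogonality d (r : rep d) M : (0 < d)%N -> schur r ->
  \sum_(y : gT) \tr (r y *m M) *: r y^-1%g = (#|gT|%:R / d%:R) *: M.
Proof.
move=> d_gt0 sr; rewrite -[M in RHS]mul1mx -[X in _ *: X]mulmx1.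
apply: fourier_of_average => X.
have id_int : intertwines r r 1%:M by move=> x; rewrite mulmx1 mul1mx.
have := mul_average_scalar X d_gt0 sr id_int; rewrite mul1mx => ->.
by rewrite scale_scalar_mx mulr1 mulrAC.
Qed.

(** The case of orthogonality that serves for branching: r2 is the restriction
    of an irreducible representation of a larger group, which contains r1 once,
    so that T S is the projection onto this copy. *)
Lemma fourier_multiplicity_one d e (r1 : rep d) (r2 : rep e) S T M :
    (0 < d)%N -> schur r1 -> intertwines r1 r2 S -> S *m T = 1%:M ->
    (forall T', intertwines r2 r1 T' -> exists a, T' = a *: T) ->
  \sum_(y : gT) \tr (r1 y *m M) *: r2 y^-1%g
  = (#|gT|%:R / d%:R) *: (T *m M *m S).
Proof.
move=> d_gt0 sr hS ST1 T_uniq; apply: fourier_of_average => X.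
have [a Ea] := T_uniq _ (average_intertwines r2 r1 X).
have := mul_average_scalar X d_gt0 sr hS.
rewrite Ea -scalemxAr ST1 scale_scalar_mx mulr1 => /matrixP.
move=> /(_ (Ordinal d_gt0) (Ordinal d_gt0)); rewrite !mxE eqxx !mulr1n => ->.
by rewrite mulrAC.
Qed.

End Intertwiners.

(** * The point stabilizer S(n) of S(n+1) *)
Section PermutationReversal.
Variables (T : finType) (a : T).
Implicit Type x : {perm T}.

Lemma perm_expN_eq x k m z :
  (x ^+ k)%g z = (x ^+ m)%g z -> (x ^- k)%g z = (x ^- m)%g z.
Proof.
move=> e; apply: (@perm_inj _ (x ^+ (k + m))%g).
by rewrite -!permM {2}addnC !expgD !mulKg e.
Qed.

(** Reverse each cycle around a base point, x^k z |-> x^-k z, and take a as the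
    base point of its own cycle. *)
Lemma perm_reversal x : exists2 g : {perm T}, g a = a & (x ^ g = x^-1)%g.
Proof.
(* The base points: rep chooses one in each cycle O. *)
pose rep (O : {set T}) := if a \in O then a else odflt a [pick z in O].
pose r y := rep (porbit x y).
have r_in y : r y \in porbit x y.
  rewrite /r /rep; case: ifP => // _; case: pickP => //= /(_ y).
  by rewrite porbit_id.
have ex_k y : exists k, y == (x ^+ k)%g (r y).
  by have := r_in y; rewrite porbit_sym => /porbitP[k {1}->]; exists k.
pose k y := ex_minn (ex_k y).
have kP y : y = (x ^+ k y)%g (r y) by rewrite /k; case: ex_minnP => m /eqP.
pose g0 y := (x ^- k y)%g (r y).
have r_exp m y : r ((x ^+ m)%g y) = r y by rewrite /r porbit_perm.
have r_expN m y : r ((x ^- m)%g y) = r y.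
  by rewrite /r -expVgn -porbitV porbit_perm porbitV.
have rr y : r (r y) = r y by rewrite [in RHS](kP y) r_exp.
have g0E m y : g0 ((x ^+ m)%g (r y)) = (x ^- m)%g (r y).
  rewrite /g0 r_exp rr; apply: perm_expN_eq.
  by have := kP ((x ^+ m)%g (r y)); rewrite r_exp rr => <-.
have g0_inj : injective g0.
  move=> y y' e; have ry : r y = r y'.
    by have := congr1 r e; rewrite /g0 !r_expN !rr.
  rewrite (kP y) (kP y') -ry; move: e; rewrite /g0 -ry -!expVgn.
  by move/perm_expN_eq; rewrite -!expVgn invgK.
exists (perm g0_inj).
  have ra : r a = a by rewrite /r /rep porbit_id.
  by have := g0E 0%N a; rewrite !expg0 invg1 !perm1 ra permE.
apply/permP => y; rewrite conjgE !permM.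
have [w ->] : exists w, y = g0 w.
  by exists ((perm g0_inj)^-1 y)%g; rewrite -(permE g0_inj) permKV.
have -> : ((perm g0_inj)^-1 (g0 w) = w)%g by rewrite -(permE g0_inj) permK.
rewrite permE [in x w](kP w) -permM -expgSr g0E.
by rewrite /g0 -!expVgn expgSr permM.
Qed.

End PermutationReversal.

Section PointStabilizer.
Variable n : nat.
Implicit Types (x : 'S_n.+1) (y : 'S_n).

Lemma Sembed_Sproj x : Sembed (Sproj x) = (x * tperm ord_max (x ord_max))%g.
Proof.
apply/permP => i; rewrite permM /Sembed.
case: (unliftP ord_max i) => [j|] ->; last by rewrite lift_perm_id tpermR.
rewrite lift_perm_lift permE lift_Sproj_fun /=.
have neq : x (lift ord_max j) != x ord_max.
  by rewrite (inj_eq perm_inj) eq_sym neq_lift.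
case: ifP => [/eqP -> | /negbT hx]; first by rewrite tpermL.
by rewrite tpermD // eq_sym.
Qed.

Lemma SembedM y1 y2 : Sembed (y1 * y2)%g = (Sembed y1 * Sembed y2)%g.
Proof. by rewrite /Sembed lift_permM. Qed.

Lemma SembedV y : Sembed y^-1%g = (Sembed y)^-1%g.
Proof. by rewrite /Sembed lift_permV. Qed.

Lemma Sembed1 : Sembed (1 : 'S_n)%g = 1%g.
Proof. by rewrite /Sembed lift_perm1. Qed.

Lemma Sembed_max y : Sembed y ord_max = ord_max.
Proof. by rewrite /Sembed lift_perm_id. Qed.

Lemma Sembed_lift y i : Sembed y (lift ord_max i) = lift ord_max (y i).
Proof. by rewrite /Sembed lift_perm_lift. Qed.

Lemma odd_Sembed y : odd_perm (Sembed y) = odd_perm y.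
Proof. by rewrite /Sembed odd_lift_perm addbb. Qed.

Lemma Sembed_inj : injective (@Sembed n).
Proof. exact: can_inj (@SembedK n). Qed.

(** The parametrization of S(n+1) that makes Lz a right translation. *)
Lemma sum_cosets (V : nmodType) (h : 'S_n.+1 -> V) :
  \sum_x h x = \sum_(y : 'S_n) \sum_(j < n.+1) h (Sembed y * tperm ord_max j)%g.
Proof.
rewrite pair_big /= (reindex (fun p : 'S_n * 'I_n.+1 =>
  (Sembed p.1 * tperm ord_max p.2)%g)) //=.
exists (fun x => (Sproj x, x ord_max)) => [[y j] _ | x _] /=.
  have jE : (Sembed y * tperm ord_max j)%g ord_max = j.
    by rewrite permM Sembed_max tpermL.
  congr pair => //; apply: Sembed_inj.
  by rewrite Sembed_Sproj jE -mulgA tperm2 mulg1.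
by rewrite Sembed_Sproj -mulgA tperm2 mulg1.
Qed.

Lemma conj_inv_Sembed x : exists y : 'S_n, (x ^ Sembed y = x^-1)%g.
Proof.
have [g gmax gx] := perm_reversal ord_max x.
by exists (Sproj g); rewrite Sembed_Sproj gmax tperm1 mulg1.
Qed.

End PointStabilizer.

(** * Multiplicity-free restriction to S(n) *)
Section Centralizer.
Variables (F : numFieldType) (n e : nat).
Variable r : mx_representation F [set: 'S_n.+1] e.
Hypotheses (e_gt0 : (0 < e)%N) (sr : schur r).

Lemma res_repr_subproof : mx_repr [set: 'S_n] (fun y => r (Sembed y)).
Proof.
by split=> [|y1 y2 _ _]; rewrite ?Sembed1 ?repr_mx1 // SembedM reprM.
Qed.

Definition res_repr : mx_representation F [set: 'S_n] e :=
  MxRepresentation res_repr_subproof.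

(** By orthogonality a is x |-> tr (r x^-1 X) up to a constant; it is invariant
    under conjugation by S(n), and inversion is induced by such conjugations. *)
Lemma centralizer_expand (X : 'M[F]_e) : intertwines res_repr res_repr X ->
  exists2 a : 'S_n.+1 -> F, X = \sum_x a x *: r x &
    [/\ forall x y, a (x ^ Sembed y)%g = a x & forall x, a x^-1%g = a x].
Proof.
move=> hX; pose k : F := #|'S_n.+1|%:R / e%:R.
have k_neq0 : k != 0.
  by rewrite mulf_neq0 ?invr_eq0 ?pnatr_eq0 -?lt0n // (cardD1 1%g).
pose a x := k^-1 * \tr (r x^-1%g *m X).
have a_conj x y : a (x ^ Sembed y)%g = a x.
  rewrite /a conjgE !invMg !invgK !reprM -!mulmxA.
  have := hX y; rewrite /= => ->.
  by rewrite mxtrace_mulC -!mulmxA reprVK mulmx1.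
exists a; last first.
  by split=> // x; have [y <-] := conj_inv_Sembed x; rewrite a_conj.
rewrite (reindex_inj invg_inj) /=.
under eq_bigr => x _ do rewrite /a invgK -scalerA.
by rewrite -scaler_sumr schur_orthogonality // scalerA mulVf // scale1r.
Qed.

(** The antiautomorphism x |-> x^-1 fixes the S(n)-invariant elements of the
    group algebra, hence these commute. *)
Lemma centralizer_comm (X Y : 'M[F]_e) : intertwines res_repr res_repr X ->
  intertwines res_repr res_repr Y -> X *m Y = Y *m X.
Proof.
move=> /centralizer_expand[a -> [a_conj aV]].
move=> /centralizer_expand[b -> [b_conj bV]].
pose m g := \sum_x a x * b (x^-1 * g)%g.
have m_conj g y : m (g ^ Sembed y)%g = m g.
  rewrite /m (reindex_inj (conjg_inj (Sembed y))) /=; apply: eq_bigr => x _.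
  by rewrite -conjVg -conjMg a_conj b_conj.
have -> : (\sum_x a x *: r x) *m (\sum_x b x *: r x) = \sum_g m g *: r g.
  rewrite mulmx_suml; under [RHS]eq_bigr => g _ do rewrite scaler_suml.
  rewrite exchange_big /=; apply: eq_bigr => x _.
  rewrite mulmx_sumr (reindex_inj (mulgI x^-1%g)) /=; apply: eq_bigr => g _.
  by rewrite -scalemxAl -scalemxAr scalerA -reprM mulKVg.
have -> : (\sum_x b x *: r x) *m (\sum_x a x *: r x) = \sum_g m g^-1%g *: r g.
  rewrite mulmx_sumr (reindex_inj invg_inj) /=.
  under [RHS]eq_bigr => g _ do rewrite scaler_suml.
  rewrite exchange_big /=; apply: eq_bigr => x _.
  rewrite mulmx_suml (reindex_inj (mulIg x)) /=; apply: eq_bigr => g _.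
  by rewrite -scalemxAl -scalemxAr scalerA -reprM mulgK aV -invMg bV mulrC.
by apply: eq_bigr => g _; have [y <-] := conj_inv_Sembed g; rewrite m_conj.
Qed.

End Centralizer.

Section Branching.
Variables (F : numFieldType) (n d e : nat).
Variables (r1 : mx_representation F [set: 'S_n] d).
Variables (r2 : mx_representation F [set: 'S_n.+1] e).
Hypotheses (d_gt0 : (0 < d)%N) (sr1 : schur r1) (sr2 : schur r2).

(** If T and T' both go back from r2 to r1, then T S and T' S centralize S(n) and
    must commute; composing T S T' S = T' S T S with T, and using that S T' is a
    scalar, makes T' a multiple of T. *)
Lemma branching (S : 'M[F]_(d, e)) : S != 0 ->
    intertwines r1 (res_repr r2) S ->
  exists T, [/\ S *m T = 1%:M, intertwines (res_repr r2) r1 T &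
    forall T', intertwines (res_repr r2) r1 T' -> exists a, T' = a *: T].
Proof.
move=> S_neq0 hS; set r2' := res_repr r2 in hS *.
have e_gt0 : (0 < e)%N.
  rewrite lt0n; apply: contraNneq S_neq0 => e0; apply/eqP/matrixP => i j.
  by have := ltn_ord j; rewrite {2}e0.
have [i [j Sij]] : exists i j, S i j != 0.
  apply: contrapT => S0; case/eqP: S_neq0; apply/matrixP => i j; rewrite mxE.
  by apply/eqP; apply: contrapT => Sij; apply: S0; exists i, j; apply/negP.
pose X : 'M[F]_(e, d) := delta_mx j i; pose k := #|'S_n|%:R * S i j / d%:R.
have trSX : \tr (S *m X) = S i j.
  rewrite mxtrace_mulC /mxtrace (bigD1 j) //= big1 ?addr0 => [|w wj].
    rewrite mxE (bigD1 i) //= big1 ?addr0 => [|w wi]; rewrite mxE ?eqxx ?mul1r //.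
    by rewrite (negPf wi) andbF mul0r.
  by rewrite mxE big1 // => w' _; rewrite mxE (negPf wj) mul0r.
have k_neq0 : k != 0.
  by rewrite !mulf_neq0 ?invr_eq0 ?pnatr_eq0 -?lt0n // (cardD1 1%g).
pose T := k^-1 *: average r2' r1 X.
have hT : intertwines r2' r1 T.
  by move=> x; rewrite -scalemxAr average_intertwines scalemxAl.
have ST : S *m T = 1%:M.
  rewrite -scalemxAr mul_average_scalar // trSX scale_scalar_mx.
  by rewrite mulVf.
exists T; split=> // T' hT'.
have [a Ea] := sr1 (intertwines_mul hS hT').
have := centralizer_comm e_gt0 sr2 (intertwines_mul hT hS) (intertwines_mul hT' hS).
move=> /(congr1 (mulmx^~ T)); rewrite -!mulmxA ST !mulmx1 !mulmxA -mulmxA Ea.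
rewrite -[T' *m S *m T]mulmxA ST mulmx1 => <-.
by exists a; rewrite mul_mx_scalar.
Qed.

End Branching.

(** * Signed sums over subgroups of the symmetric group *)
Section Adjoint.
Variable F : numClosedFieldType.

Definition adjmx m n (A : 'M[F]_(m, n)) : 'M[F]_(n, m) := map_mx Num.conj A^T.

Lemma adjmxM m n p (A : 'M[F]_(m, n)) (B : 'M_(n, p)) :
  adjmx (A *m B) = adjmx B *m adjmx A.
Proof. by rewrite /adjmx trmx_mul map_mxM. Qed.

Lemma mul_adjmx_eq0 m n (A : 'M[F]_(m, n)) : A *m adjmx A = 0 -> A = 0.
Proof.
move=> A0; apply/matrixP => i j; rewrite mxE.
have := congr1 (fun M : 'M_m => M i i) A0; rewrite !mxE => /eqP.
rewrite psumr_eq0 => [|k _]; last by rewrite !mxE mul_conjC_ge0.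
by move=> /allP/(_ j); rewrite mem_index_enum !mxE mul_conjC_eq0 => /(_ isT)/eqP.
Qed.

End Adjoint.

Section SignedSums.
Variables (F : numFieldType) (n : nat).
Local Notation rep := (mx_representation F [set: 'S_n]).
Implicit Types (A B : {group 'S_n}) (s : bool).

(** The flag s tells whether signs are present, so that row sums and alternating
    column sums are treated together. *)
Definition signed_sum d (r : rep d) s (A : {set 'S_n}) : 'M[F]_d :=
  \sum_(x in A) (-1) ^+ (s && odd_perm x) *: r x.

Lemma sign_and_permM s (x y : 'S_n) : (-1) ^+ (s && odd_perm (x * y)%g) =
  (-1) ^+ (s && odd_perm x) * (-1) ^+ (s && odd_perm y) :> F.
Proof. by case: s; rewrite ?mulr1 //= odd_permM signr_addb. Qed.

Lemma signed_sum_mulr d (r : rep d) s A y : y \in A ->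
  signed_sum r s A *m r y = (-1) ^+ (s && odd_perm y) *: signed_sum r s A.
Proof.
move=> Ay; rewrite mulmx_suml scaler_sumr [RHS](reindex_inj (mulIg y)) /=.
apply: eq_big => [x|x Ax]; first by rewrite groupMr.
by rewrite -scalemxAl -reprM scalerA sign_and_permM mulrCA -expr2 sqrr_sign mulr1.
Qed.

Lemma signed_sum_mull d (r : rep d) s A y : y \in A ->
  r y *m signed_sum r s A = (-1) ^+ (s && odd_perm y) *: signed_sum r s A.
Proof.
move=> Ay; rewrite mulmx_sumr scaler_sumr [RHS](reindex_inj (mulgI y)) /=.
apply: eq_big => [x|x Ax]; first by rewrite groupMl.
by rewrite -scalemxAr -reprM scalerA sign_and_permM mulrA -expr2 sqrr_sign mul1r.
Qed.

Lemma signed_sum_sub d (r : rep d) s A B : B \subset A ->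
  signed_sum r s A *m signed_sum r s B = #|B|%:R *: signed_sum r s A.
Proof.
move=> sBA; rewrite mulmx_sumr (eq_bigr (fun=> signed_sum r s A)) => [|y By].
  by rewrite sumr_const scaler_nat.
rewrite -scalemxAr (signed_sum_mulr _ _ (fintype.subsetP sBA _ By)).
by rewrite scalerA -expr2 sqrr_sign scale1r.
Qed.

Lemma signed_sum_conj d (r : rep d) s (A : {set 'S_n}) y :
  r y *m signed_sum r s (A :^ y)%g = signed_sum r s A *m r y.
Proof.
rewrite mulmx_sumr mulmx_suml (reindex_inj (conjg_inj y)) /=.
apply: eq_big => [x|x Ax]; first by rewrite memJ_conjg.
by rewrite -scalemxAr -scalemxAl -!reprM -conjgC odd_permJ.
Qed.

End SignedSums.

Section Regular.
Variables (F : numClosedFieldType) (n : nat).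
Local Notation Sn := [set: 'S_n].
Local Notation reg := (regular_repr F Sn).

(** The coefficient of x in an element of the group algebra, the latter being
    represented by the matrix of its right multiplication. *)
Definition gcoef (x : 'S_n) (A : 'M[F]_#|Sn|) : F :=
  A (gring_index Sn 1%g) (gring_index Sn x).

Lemma gcoef_reg x y : gcoef x (reg y) = (y == x)%:R.
Proof.
rewrite /gcoef mxE gring_indexK ?inE // mul1g mxE eqxx /=.
by rewrite (can_in_eq (@gring_indexK _ _)) ?inE // eq_sym.
Qed.

Lemma gcoef_sum x (I : finType) (P : pred I) (a : I -> F) (f : I -> 'S_n) :
  gcoef x (\sum_(i | P i) a i *: reg (f i)) = \sum_(i | P i) a i * (f i == x)%:R.
Proof.
rewrite /gcoef summxE; apply: eq_bigr => i _.
by rewrite mxE -[reg _ _ _]/(gcoef x (reg (f i))) gcoef_reg.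
Qed.

Lemma adjmx_reg x : adjmx (reg x) = reg x^-1%g.
Proof.
apply/matrixP => i j; rewrite !mxE /= conjC_nat; congr (_%:R).
rewrite -(gring_valK i) -(gring_valK j) !gring_indexK ?inE //.
rewrite !(can_in_eq (@gring_indexK _ _)) ?inE //.
by rewrite -(inj_eq (mulIg x) (enum_val j)) mulgKV eq_sym.
Qed.

Lemma adjmx_signed_sum s (A : {group 'S_n}) :
  adjmx (signed_sum reg s A) = signed_sum reg s A.
Proof.
rewrite /adjmx /signed_sum raddf_sum raddf_sum (reindex_inj invg_inj) /=.
apply: eq_big => [x|x Ax]; first by rewrite groupV.
rewrite linearZ /= map_mxZ /= rmorph_sign -/(adjmx (reg _)) adjmx_reg invgK.
by rewrite odd_permV.
Qed.

(** Write the product as Y D R0 D. All factors are self-adjoint and R0^2 is a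
    multiple of R0, so that if the product vanishes, then so does
    (Y D R0)(Y D R0)*, hence also Y D R0, which is a multiple of Y R0. But the
    coefficient of 1 in Y R0 is the order of P0, since p q p0 = 1 forces q to lie
    in both P and Q. *)
Lemma signed_sums_neq0 (P Q P0 Q0 : {group 'S_n}) :
    P0 \subset P -> Q0 \subset Q -> P :&: Q = 1%g ->
  signed_sum reg false P *m signed_sum reg true Q *m signed_sum reg true Q0
    *m signed_sum reg false P0 *m signed_sum reg true Q0 != 0.
Proof.
move=> sP sQ PQ1; set RP := signed_sum reg false P.
set CQ := signed_sum reg true Q; set D := signed_sum reg true Q0.
set R0 := signed_sum reg false P0; apply/eqP => h0.
have nz (A : {group 'S_n}) : #|A|%:R != 0 :> F.
  by rewrite pnatr_eq0 -lt0n cardG_gt0.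
have h1 : RP *m CQ *m D *m R0 = 0.
  apply: mul_adjmx_eq0; rewrite !adjmxM !adjmx_signed_sum -/RP -/CQ -/D -/R0.
  rewrite !mulmxA -[_ *m R0 *m R0]mulmxA signed_sum_sub //.
  by rewrite -/R0 -scalemxAr -!scalemxAl h0 !mul0mx scaler0.
have h2 : RP *m CQ *m R0 = 0.
  apply: (scalerI (nz Q0)); rewrite scaler0 -[RHS]h1 -[RP *m CQ *m D]mulmxA.
  by rewrite signed_sum_sub // -scalemxAr -!scalemxAl.
have: gcoef 1%g (RP *m CQ *m R0) = #|P0|%:R; last first.
  by rewrite h2 /gcoef mxE => /esym/eqP; rewrite (negPf (nz P0)).
have -> : RP *m CQ *m R0 = \sum_(u : 'S_n * ('S_n * 'S_n) |
      (u.1 \in P0) && ((u.2.1 \in P) && (u.2.2 \in Q)))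
    (-1) ^+ odd_perm u.2.2 *: reg (u.2.1 * u.2.2 * u.1)%g.
  rewrite mulmx_sumr -(pair_big_dep (mem P0) (fun _ v => (v.1 \in P) && (v.2 \in Q))
    (fun w v => (-1) ^+ odd_perm v.2 *: reg (v.1 * v.2 * w)%g)).
  apply: eq_bigr => w Pw; rewrite scale1r 2!mulmx_suml.
  rewrite -(pair_big_dep (mem P) (fun _ v => v \in Q)
    (fun x y => (-1) ^+ odd_perm y *: reg (x * y * w)%g)).
  apply: eq_bigr => x Px; rewrite scale1r mulmx_sumr mulmx_suml.
  by apply: eq_bigr => y Qy; rewrite -scalemxAr -scalemxAl !reprM.
rewrite gcoef_sum.
rewrite -(pair_big_dep (mem P0) (fun _ v => (v.1 \in P) && (v.2 \in Q))
  (fun w v => (-1) ^+ odd_perm v.2 * ((v.1 * v.2 * w)%g == 1%g)%:R)) /=.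
rewrite -sumr_const; apply: eq_bigr => w P0w.
have Pw := fintype.subsetP sP _ P0w.
rewrite (bigD1 (w^-1%g, 1%g)) /=; last by rewrite groupV Pw group1.
rewrite mulg1 mulVg eqxx odd_perm1 mul1r big1 ?addr0 // => -[x y] /=.
case/andP=> /andP[Px Qy] xy_neq; case: eqP => [xyw|]; last by rewrite mulr0.
have y1 : y = 1%g.
  apply/set1gP; rewrite -PQ1 inE Qy andbT.
  by rewrite -(groupMl _ Px) -(groupMr _ Pw) xyw group1.
case/eqP: xy_neq; rewrite y1; congr pair.
by apply: (mulIg w); rewrite mulVg -xyw y1 mulg1.
Qed.

End Regular.

(** * Fillings and von Neumann's lemma *)
Section Fillings.
Variables (n : nat) (r c : 'I_n -> nat) (l : nat -> nat).
Hypothesis c_lt : forall k, (c k < l (r k))%N.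
Hypothesis rc_inj : forall k k', r k = r k' -> c k = c k' -> k = k'.
Hypothesis rc_surj : forall i j, (j < l i)%N -> exists2 k, r k = i & c k = j.

Lemma card_row_cut i m :
  #|[pred k | (r k == i) && (c k < m)%N]| = minn (l i) m.
Proof.
rewrite cardE -(size_map c) -[RHS](size_iota 0); apply: perm_size.
apply: uniq_perm; rewrite ?iota_uniq // ?map_inj_in_uniq ?enum_uniq //.
  move=> k k'; rewrite !mem_enum !inE => /andP[/eqP rk _] /andP[/eqP rk' _].
  by apply: rc_inj; rewrite rk rk'.
move=> j; rewrite mem_iota leq0n /= add0n leq_min; apply/mapP/andP => [[k]|[jl jm]].
  by rewrite mem_enum inE => /andP[/eqP <- km] ->; rewrite ?c_lt; split.
by have [k rk ck] := rc_surj jl; exists k; rewrite ?mem_enum ?inE ?rk ?ck ?eqxx.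
Qed.

Lemma card_col_cut j m :
  #|[pred k | (c k == j) && (r k < m)%N]| = count (fun i => (j < l i)%N) (iota 0 m).
Proof.
rewrite cardE -(size_map r) -size_filter; apply: perm_size.
apply: uniq_perm; rewrite ?filter_uniq ?iota_uniq // ?map_inj_in_uniq ?enum_uniq //.
  move=> k k'; rewrite !mem_enum !inE => /andP[/eqP ck _] /andP[/eqP ck' _].
  by move=> rk; apply: rc_inj; rewrite // ck ck'.
move=> i; rewrite mem_filter mem_iota leq0n /= add0n; apply/mapP/andP => [[k]|[jl im]].
  by rewrite mem_enum inE => /andP[/eqP <- km] ->; rewrite ?c_lt; split.
by have [k rk ck] := rc_surj jl; exists k; rewrite ?mem_enum ?inE ?rk ?ck ?eqxx.
Qed.

Lemma card_by_rows (P : pred 'I_n) N : (forall k, r k < N)%N ->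
  #|P| = \sum_(i < N) #|[pred k | (r k == i) && P k]|.
Proof.
move=> rN; rewrite -sum1_card (partition_big (fun k => Ordinal (rN k)) predT) //=.
apply: eq_bigr => i _; rewrite -sum1_card; apply: eq_bigl => k.
by rewrite !inE andbC -val_eqE.
Qed.

(** A counting proof. By hypothesis at most min (l i) m entries of row i are
    mapped to the first m columns, and these columns hold sum_i min (l i) m
    entries altogether; therefore all the bounds are attained. For m = l i this
    says that row i is mapped to the first l i columns. *)
Lemma col_lt_row (g : 'S_n) :
    (forall k k', r k = r k' -> c (g k) = c (g k') -> k = k') ->
  forall k, (c (g k) < l (r k))%N.
Proof.
move=> g_inj k0; set m := l (r k0); pose N := (\max_k r k)%N.+1.
have rN k : (r k < N)%N by rewrite ltnS leq_bigmax.
pose a i := #|[pred k | (r k == i) && (c (g k) < m)%N]|.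
have a_le i : (a i <= minn (l i) m)%N.
  rewrite leq_min; apply/andP; split.
    rewrite -(minnn (l i)) -card_row_cut; apply: subset_leq_card.
    by apply/fintype.subsetP => k; rewrite !inE => /andP[/eqP <- _]; rewrite eqxx c_lt.
  rewrite /a cardE -(size_map (c \o g)) -[leqRHS](size_iota 0).
  apply: uniq_leq_size => [|j].
    rewrite map_inj_in_uniq ?enum_uniq // => k k'; rewrite !mem_enum !inE.
    by move=> /andP[/eqP rk _] /andP[/eqP rk' _]; apply: g_inj; rewrite rk rk'.
  by case/mapP=> k; rewrite mem_enum inE => /andP[_ km] ->; rewrite mem_iota.
have sum_eq : \sum_(i < N) a i = \sum_(i < N) minn (l i) m.
  transitivity #|[pred k | c (g k) < m]%N|; first by rewrite (card_by_rows _ rN).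
  transitivity #|[pred k | c k < m]%N|.
    by rewrite -!sum1_card [RHS](reindex_inj (@perm_inj _ g)).
  by rewrite (card_by_rows _ rN); apply: eq_bigr => i _; rewrite -card_row_cut.
have a_eq i : (i < N)%N -> a i = minn (l i) m.
  move=> iN; apply/eqP; rewrite eqn_leq a_le leqNgt /=; apply/negP => lt_i.
  have := sum_eq; apply/eqP; rewrite neq_ltn; apply/orP; left.
  rewrite (bigD1 (Ordinal iN)) //= [ltnRHS](bigD1 (Ordinal iN)) //=.
  by rewrite -addSn leq_add // leq_sum.
have := a_eq (r k0) (rN k0); rewrite -/m -card_row_cut => a_full.
have /subset_leqif_card sub : [pred k | (r k == r k0) && (c (g k) < m)%N]
    \subset [pred k | (r k == r k0) && (c k < m)%N].
  by apply/fintype.subsetP => k; rewrite !inE => /andP[/eqP rk _];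
    rewrite rk eqxx /m -rk c_lt.
have := sub.2; rewrite [in X in X = _]/= -/(a _) a_full eqxx.
move=> /esym/fintype.subsetP/(_ k0).
by rewrite !inE eqxx c_lt => /(_ isT).
Qed.

Definition stab (f : 'I_n -> nat) : {set 'S_n} :=
  [set p : 'S_n | [forall k, f (p k) == f k]].

Lemma stabP f (p : 'S_n) : reflect (forall k, f (p k) = f k) (p \in stab f).
Proof. by rewrite inE; apply: forallPP => k; apply: eqP. Qed.

Lemma stab_group_set f : group_set (stab f).
Proof.
apply/group_setP; split=> [|p q /stabP hp /stabP hq].
  by apply/stabP => k; rewrite perm1.
by apply/stabP => k; rewrite permM hq hp.
Qed.
Canonical stab_group f := Group (stab_group_set f).

Lemma stab_trivI : stab r :&: stab c = 1%g.
Proof.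
apply/setP => p; rewrite !inE; apply/andP/eqP => [[/forallP hr /forallP hc]|->].
  by apply/permP => k; rewrite perm1; apply: rc_inj; apply/eqP.
by split; apply/forallP => k; rewrite perm1.
Qed.

Lemma tperm_stab f i j : (tperm i j \in stab f) = (f i == f j).
Proof.
apply/stabP/eqP => [/(_ i)|fij k]; first by rewrite tpermL.
by case: tpermP => // ->.
Qed.

(** The permutation p moves each k inside its row to the column of g k; the box
    that is needed exists by the previous counting. *)
Lemma row_col_factor (g : 'S_n) :
    (forall k k', r k = r k' -> c (g k) = c (g k') -> k = k') ->
  exists p q, [/\ p \in stab r, q \in stab c & g = (p * q)%g].
Proof.
move=> g_inj; have lt_g := col_lt_row g_inj.
have /boolp.choice[p0 p0E] : forall k, exists k', r k' = r k /\ c k' = c (g k).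
  by move=> k; have [k' rk ck] := rc_surj (lt_g k); exists k'.
have p0_inj : injective p0.
  move=> k k' e; have [rk ck] := p0E k; have [rk' ck'] := p0E k'.
  by apply: g_inj; rewrite -?rk -?ck e.
exists (perm p0_inj), ((perm p0_inj)^-1 * g)%g; split; last by rewrite mulKVg.
  by apply/stabP => k; rewrite permE; case: (p0E k).
apply/stabP => k; rewrite permM.
by have [_ <-] := p0E ((perm p0_inj)^-1%g k); rewrite -(permE p0_inj) permKV.
Qed.

Variable F : numFieldType.

(** Either g is in the row group times the column group, or a transposition t
    exchanges two entries of a row that g maps to the same column; then t is
    absorbed by the row sum, and t ^ g changes the sign of the column sum. *)
Lemma young_row_col d (rho : mx_representation F [set: 'S_n] d) (g : 'S_n) :
  exists b : F, signed_sum rho false (stab r) *m rho g *m signed_sum rho true (stab c)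
   = b *: (signed_sum rho false (stab r) *m signed_sum rho true (stab c)).
Proof.
have [g_inj|] := pselect (forall k k', r k = r k' -> c (g k) = c (g k') -> k = k').
  have [p [q [hp hq ->]]] := row_col_factor g_inj.
  exists ((-1) ^+ odd_perm q).
  rewrite reprM !mulmxA (signed_sum_mulr _ _ hp) /= scale1r -mulmxA.
  by rewrite (signed_sum_mull _ _ hq) scalemxAr.
move=> /existsNP[k /existsNP[k' /not_implyP[rk /not_implyP[ck /eqP nkk']]]].
exists 0; rewrite scale0r; set X := _ *m _ *m _.
suff XN : X = - X.
  have two_neq0 : 2%:R != 0 :> F by rewrite pnatr_eq0.
  by apply: (scalerI two_neq0); rewrite scaler0 scaler_nat mulr2n {1}XN addNr.
have tr : tperm k k' \in stab r by rewrite tperm_stab rk.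
have tc : (tperm k k' ^ g)%g \in stab c by rewrite tpermJ tperm_stab ck.
have := signed_sum_mulr rho false tr; rewrite scale1r => Rt.
have := signed_sum_mull rho true tc; rewrite odd_permJ odd_tperm nkk' scaleN1r => tC.
by rewrite {1}/X -Rt -[_ *m rho _ *m rho g]mulmxA -reprM conjgC reprM !mulmxA
  -[LHS]mulmxA tC mulmxN.
Qed.

End Fillings.

(** * Specht modules *)
Section DiagramFilling.
Variables (n : nat) (lam : diagram n).

Lemma diagram_ltn (k : 'I_n) : (k < sumn lam)%N.
Proof. by rewrite rows_sum ltn_ord. Qed.

Lemma reshape_lt (k : 'I_n) :
  (reshape_offset lam k < nth 0 lam (reshape_index lam k))%N.
Proof. exact/reshape_offsetP/diagram_ltn. Qed.

Lemma reshape_inj (k k' : 'I_n) : reshape_index lam k = reshape_index lam k' ->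
  reshape_offset lam k = reshape_offset lam k' -> k = k'.
Proof.
move=> e1 e2; apply: val_inj => /=.
by rewrite -(reshape_indexK lam k) -(reshape_indexK lam k') e1 e2.
Qed.

Lemma reshape_surj i j : (j < nth 0 lam i)%N ->
  exists2 k : 'I_n, reshape_index lam k = i & reshape_offset lam k = j.
Proof.
move=> ji; have := flatten_indexP ji; rewrite rows_sum => lt_n.
by exists (Ordinal lt_n); rewrite /= ?flatten_indexKl ?flatten_indexKr.
Qed.

End DiagramFilling.

Lemma intertwines_sum (F : numFieldType) (gT : finGroupType) d e
    (r1 : mx_representation F [set: gT] d)
    (r2 : mx_representation F [set: gT] e) S (A : {set gT}) (a : gT -> F) :
  intertwines r1 r2 S ->
  (\sum_(x in A) a x *: r1 x) *m S = S *m \sum_(x in A) a x *: r2 x.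
Proof.
move=> hS; rewrite mulmx_suml mulmx_sumr; apply: eq_bigr => x _.
by rewrite -scalemxAl hS scalemxAr.
Qed.

Lemma intertwines_signed_sum (F : numFieldType) n d e
    (r1 : mx_representation F [set: 'S_n] d)
    (r2 : mx_representation F [set: 'S_n] e) S s (A : {set 'S_n}) :
  intertwines r1 r2 S -> signed_sum r1 s A *m S = S *m signed_sum r2 s A.
Proof. exact: intertwines_sum. Qed.

Lemma gring_row_eq0 (F : fieldType) (gT : finGroupType) (G : {group gT}) A :
  (A \in group_ring F G)%MS -> gring_row A = 0 -> A = 0.
Proof. by move=> RA A0; rewrite -(gring_rowK RA) A0 linear0. Qed.

Lemma gring_row_reg (F : fieldType) (gT : finGroupType) (G : {group gT}) x :
  gring_row (regular_repr F G x) = delta_mx 0 (gring_index G x).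
Proof. by rewrite /gring_row rowK gring_indexK // mul1g. Qed.

Lemma signed_sum_group_ring (F : numFieldType) n s (A : {set 'S_n}) :
  (signed_sum (regular_repr F [set: 'S_n]) s A \in group_ring F [set: 'S_n])%MS.
Proof.
rewrite linear_sum summx_sub // => x _.
by rewrite linearZ scalemx_sub ?envelop_mx_id ?inE.
Qed.

Section Specht.
Variables (R : realType) (n : nat) (lam : diagram n).
Local Notation C := R[i].
Local Notation Sn := [set: 'S_n].
Local Notation reg := (regular_repr C Sn).
Local Notation rho := (specht R lam).
Local Notation d := (dim_diagram R lam).
Local Notation ysym := (young_symmetrizer R lam).
Local Notation row_of := (fun k : 'I_n => reshape_index lam k).
Local Notation col_of := (fun k : 'I_n => reshape_offset lam k).

Definition youngmx e (r : mx_representation C Sn e) : 'M[C]_e :=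
  signed_sum r false (row_stab lam) *m signed_sum r true (col_stab lam).

Lemma young_symmetrizerE : ysym = gring_row (youngmx reg).
Proof.
rewrite /youngmx mulmx_suml linear_sum; apply: eq_bigr => p _.
rewrite scale1r mulmx_sumr linear_sum; apply: eq_bigr => q _.
by rewrite -scalemxAr -reprM linearZ /= -gring_row_reg.
Qed.

(** Non-vanishing of R C C R C, where C^2 is a multiple of C. *)
Lemma young_square_neq0 : youngmx reg *m youngmx reg != 0.
Proof.
have := @signed_sums_neq0 C n (stab_group row_of) (stab_group col_of) _ _
  (subxx _) (subxx _) (stab_trivI (@reshape_inj n lam)).
apply: contra_neq => YY0.
rewrite -[signed_sum _ _ _ *m _ *m signed_sum _ true (stab_group _) in LHS]mulmxA.
rewrite signed_sum_sub // -scalemxAr -!scalemxAl.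
by rewrite -mulmxA YY0 scaler0.
Qed.

Lemma youngmx_group_ring : (youngmx reg \in group_ring C Sn)%MS.
Proof. by rewrite envelop_mxM // signed_sum_group_ring. Qed.

Lemma young_symmetrizer_neq0 : ysym != 0.
Proof.
rewrite young_symmetrizerE; apply: contraNneq young_square_neq0.
by move=> /gring_row_eq0 ->; rewrite ?mulmx0 // youngmx_group_ring.
Qed.

Lemma dim_diagram_gt0 : (0 < d)%N.
Proof. by rewrite lt0n mxrank_eq0 cyclic_mx_eq0 young_symmetrizer_neq0. Qed.

(** The isomorphism of the Specht module with a right ideal of the group
    algebra, as the matrix of a basis of this ideal. *)
Definition specht_basis : 'M[C]_(d, #|Sn|) := row_base (specht_mx R lam).
Local Notation U := specht_basis.

Lemma specht_basis_intertwines : intertwines rho reg U.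
Proof.
move=> x; have := val_submodJ (cyclic_mx_module reg ysym) 1%:M (finset.in_setT x).
by rewrite mul1mx /val_submod /= mul1mx.
Qed.

Lemma specht_basis_free : row_free U.
Proof. exact: row_base_free. Qed.

Lemma specht_basis_inj m : injective (fun v : 'M[C]_(m, d) => v *m U).
Proof. exact/row_free_inj/specht_basis_free. Qed.

Lemma sub_spechtP (w : 'rV[C]_#|Sn|) :
  (exists2 B, B \in group_ring C Sn & w = ysym *m B)%MS ->
  exists v : 'rV[C]_d, v *m U = w.
Proof.
move=> /cyclic_mxP; rewrite -/(specht_mx R lam) -(eq_row_base (specht_mx R lam)).
by case/submxP=> v ->; exists v.
Qed.

Lemma specht_generated (v : 'rV[C]_d) :
  exists2 B, (B \in group_ring C Sn)%MS & v *m U = ysym *m B.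
Proof.
apply/cyclic_mxP; rewrite -/(specht_mx R lam) -(eq_row_base (specht_mx R lam)).
exact: submxMl.
Qed.

(** The Young symmetrizer, in the coordinates of the Specht module. *)
Definition specht_gen : 'rV[C]_d := in_submod (specht_mx R lam) ysym.
Local Notation u0 := specht_gen.

Lemma specht_genE : u0 *m U = ysym.
Proof. exact/in_submodK/cyclic_mx_id. Qed.

Lemma young_sandwich B : (B \in group_ring C Sn)%MS -> exists b,
  signed_sum reg false (row_stab lam) *m B *m signed_sum reg true (col_stab lam)
  = b *: youngmx reg.
Proof.
case/envelop_mxP=> a ->.
have /boolp.choice[b bE] := young_row_col (@reshape_lt n lam)
  (@reshape_inj n lam) (@reshape_surj n lam) reg.
exists (\sum_(x in Sn) a x * b x).
set P := signed_sum _ _ _; set Q := signed_sum _ _ _.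
rewrite scaler_suml [P *m _]mulmx_sumr mulmx_suml.
by apply: eq_bigr => x _; rewrite -scalemxAr -scalemxAl -scalerA -bE.
Qed.

Lemma young_specht_basis : youngmx rho *m U = U *m youngmx reg.
Proof.
rewrite /youngmx -mulmxA (intertwines_signed_sum _ _ specht_basis_intertwines).
by rewrite mulmxA (intertwines_signed_sum _ _ specht_basis_intertwines) mulmxA.
Qed.

(** By von Neumann's lemma c A c consists of the multiples of c. *)
Lemma young_rank1 (v : 'rV[C]_d) : exists b, v *m youngmx rho = b *: u0.
Proof.
have [B RB vE] := specht_generated v.
have [|b bE] := @young_sandwich (signed_sum reg true (col_stab lam) *m B
    *m signed_sum reg false (row_stab lam)).
  by rewrite !envelop_mxM ?signed_sum_group_ring.
exists b; apply: specht_basis_inj; rewrite -mulmxA young_specht_basis mulmxA vE.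
rewrite -scalemxAl specht_genE young_symmetrizerE -!gring_row_mul.
by rewrite -linearZ -bE /youngmx !mulmxA.
Qed.

Lemma young_gen : exists2 k, k != 0 & u0 *m youngmx rho = k *: u0.
Proof.
have [k kE] := young_rank1 u0; exists k => //.
apply: contraNneq young_square_neq0 => k0; apply/eqP.
apply: (gring_row_eq0 (envelop_mxM youngmx_group_ring youngmx_group_ring)).
rewrite gring_row_mul -young_symmetrizerE -specht_genE -mulmxA.
by rewrite -young_specht_basis mulmxA kE k0 scale0r mul0mx.
Qed.

(** An endomorphism commutes with the action of c, whose image is the line of
    the generator u0; so u0 is an eigenvector, and it generates the module. *)
Lemma specht_schur : schur rho.
Proof.
move=> X hX; have [k k_neq0 kE] := young_gen; have [b bE] := young_rank1 (u0 *m X).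
have XY : youngmx rho *m X = X *m youngmx rho.
  rewrite /youngmx -mulmxA (intertwines_signed_sum _ _ hX).
  by rewrite [LHS]mulmxA (intertwines_signed_sum _ _ hX) mulmxA.
have u0X : u0 *m X = (b / k) *: u0.
  apply: (scalerI k_neq0); rewrite scalerA mulrCA divff // mulr1 -bE.
  by rewrite -mulmxA -XY mulmxA kE scalemxAl.
exists (b / k); apply/row_matrixP => i; rewrite !rowE mul_mx_scalar.
have [_ /envelop_mxP[a ->] vE] := specht_generated (delta_mx 0 i).
have -> : delta_mx 0 i = u0 *m \sum_(x in Sn) a x *: rho x.
  apply: specht_basis_inj; rewrite vE -[RHS]mulmxA.
  by rewrite (intertwines_sum _ _ specht_basis_intertwines) mulmxA specht_genE.
by rewrite -mulmxA (intertwines_sum _ _ hX) mulmxA u0X -scalemxAl.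
Qed.

Lemma conj_reg x : map_mx Num.conj (reg x) = reg x.
Proof. exact: map_regular_mx. Qed.

Lemma conj_youngmx : map_mx Num.conj (youngmx reg) = youngmx reg.
Proof.
rewrite /youngmx map_mxM; congr (_ *m _); rewrite /signed_sum raddf_sum.
  by apply: eq_bigr => x _; rewrite /= map_mxZ /= rmorph_sign conj_reg.
by apply: eq_bigr => x _; rewrite /= map_mxZ /= rmorph_sign conj_reg.
Qed.

Lemma conj_specht_basis : exists P : 'M[C]_d, map_mx Num.conj U = P *m U.
Proof.
have /submxP[P PE] : (map_mx Num.conj U <= U)%MS; last by exists P.
apply/row_subP => i; rewrite -map_row rowE.
have [_ /envelop_mxP[a ->] ->] := specht_generated (delta_mx 0 i).
have [v <-] : exists v : 'rV[C]_d,
    v *m U = map_mx Num.conj (ysym *m \sum_(x in Sn) a x *: reg x).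
  apply: sub_spechtP; exists (\sum_(x in Sn) (a x)^* *: reg x).
    by apply/envelop_mxP; exists (fun x => (a x)^*).
  rewrite map_mxM young_symmetrizerE map_gring_row conj_youngmx.
  congr (_ *m _); rewrite raddf_sum; apply: eq_bigr => x _.
  by rewrite /= map_mxZ conj_reg.
exact: submxMl.
Qed.

(** The standard hermitian form is positive definite on the ideal. *)
Lemma specht_gram (v : 'rV[C]_d) : v *m (U *m adjmx U) = 0 -> v = 0.
Proof.
move=> vH; apply: specht_basis_inj; rewrite mul0mx; apply: mul_adjmx_eq0.
by rewrite adjmxM mulmxA -(mulmxA v) vH mul0mx.
Qed.

Lemma specht_hermitian : exists2 H : 'M[C]_d, H \in unitmx &
  forall x, rho x *m H *m adjmx (rho x) = H.
Proof.
exists (U *m adjmx U) => [|x].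
  by rewrite -row_free_unit; apply: inj_row_free => v /specht_gram.
rewrite mulmxA specht_basis_intertwines -mulmxA -adjmxM specht_basis_intertwines.
by rewrite adjmxM adjmx_reg mulmxA -(mulmxA U) -reprM mulgV repr_mx1 mulmx1.
Qed.

(** The standard bilinear form is also nondegenerate on the ideal, because the
    ideal is stable under complex conjugation, its generator being real. *)
Lemma specht_selfdual : exists2 B : 'M[C]_d, B \in unitmx &
  forall x, rho x *m B *m (rho x)^T = B.
Proof.
exists (U *m U^T) => [|x].
  have [P PE] := conj_specht_basis.
  rewrite -row_free_unit; apply: inj_row_free => v vB; apply: specht_gram.
  have -> : adjmx U = U^T *m P^T by rewrite -trmx_mul -PE map_trmx.
  by rewrite [U *m _]mulmxA mulmxA vB mul0mx.
rewrite mulmxA specht_basis_intertwines -mulmxA -trmx_mul specht_basis_intertwines.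
have regT : (reg x)^T = reg x^-1%g by rewrite -adjmx_reg /adjmx -map_trmx conj_reg.
by rewrite trmx_mul regT mulmxA -(mulmxA U) -reprM mulgV repr_mx1 mulmx1.
Qed.

(** * Sums of transpositions and contents *)
Lemma gring_rowE x (A : 'M[C]_#|Sn|) : gring_row A 0 (gring_index Sn x) = gcoef x A.
Proof. by rewrite mxE. Qed.

Lemma gcoefZ x a (A : 'M[C]_#|Sn|) : gcoef x (a *: A) = a * gcoef x A.
Proof. by rewrite /gcoef mxE. Qed.

Lemma gcoef_bigsum x (I : finType) (f : I -> 'M[C]_#|Sn|) :
  gcoef x (\sum_i f i) = \sum_i gcoef x (f i).
Proof. by rewrite /gcoef summxE. Qed.

(** Summing over all ordered pairs, i = j included, makes the sum over n + 1
    points split without side conditions. *)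
Definition tperm_sum e (r : mx_representation C Sn e) : 'M[C]_e :=
  \sum_i \sum_j r (tperm i j).

Lemma tperm_sum_intertwines e f (r1 : mx_representation C Sn e)
    (r2 : mx_representation C Sn f) S :
  intertwines r1 r2 S -> tperm_sum r1 *m S = S *m tperm_sum r2.
Proof.
move=> hS; rewrite mulmx_suml mulmx_sumr; apply: eq_bigr => i _.
by rewrite mulmx_suml mulmx_sumr; apply: eq_bigr => j _; rewrite hS.
Qed.

Lemma tperm_sum_central e (r : mx_representation C Sn e) :
  intertwines r r (tperm_sum r).
Proof.
move=> x; rewrite mulmx_suml mulmx_sumr [RHS](reindex_inj (@perm_inj _ x^-1%g)) /=.
apply: eq_bigr => i _; rewrite mulmx_suml mulmx_sumr.
rewrite [RHS](reindex_inj (@perm_inj _ x^-1%g)) /=; apply: eq_bigr => j _.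
by rewrite -tpermJ -!reprM conjgE invgK mulgA mulgKV.
Qed.

Lemma gcoef_youngmx_reg t : gcoef 1%g (youngmx reg *m reg t)
  = \sum_(q in col_stab lam | (q * t)%g \in row_stab lam) (-1) ^+ odd_perm q.
Proof.
rewrite /youngmx -mulmxA mulmx_suml.
have -> : \sum_(p in row_stab lam) (-1) ^+ (false && odd_perm p) *: reg p
    *m (signed_sum reg true (col_stab lam) *m reg t)
  = \sum_(u | (u.1 \in row_stab lam) && (u.2 \in col_stab lam))
      (-1) ^+ odd_perm u.2 *: reg (u.1 * (u.2 * t))%g.
  rewrite -(pair_big (mem (row_stab lam)) (mem (col_stab lam))
    (fun p q => (-1) ^+ odd_perm q *: reg (p * (q * t))%g)) /=.
  apply: eq_bigr => p _; rewrite scale1r mulmx_suml mulmx_sumr.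
  by apply: eq_bigr => q _; rewrite -scalemxAl -scalemxAr !reprM.
rewrite gcoef_sum -(pair_big (mem (row_stab lam)) (mem (col_stab lam))
  (fun p q => (-1) ^+ odd_perm q * ((p * (q * t))%g == 1%g)%:R)) /=.
rewrite exchange_big /= [RHS]big_mkcondr; apply: eq_bigr => q _.
rewrite -mulr_sumr -(groupV (stab_group row_of)) /=; set g := (q * t)^-1%g.
have eq_g (p : 'S_n) : ((p * (q * t))%g == 1%g) = (p == g).
  by rewrite -[(q * t)%g]invgK -eq_mulgV1.
case: ifP => [gR|/negbT gR].
  rewrite (bigD1 g) //= eq_g eqxx big1 ?addr0 ?mulr1 // => p /andP[_ pg].
  by rewrite eq_g (negPf pg).
rewrite big1 ?mulr0 // => p pR; rewrite eq_g; case: eqP => // pg.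
by case/negP: gR; rewrite -pg.
Qed.

(** For k' such that q k' = k is not moved by the transposition, k' and k are in
    the same column by the choice of q, and in the same row by that of q t, so
    that k' = k. Thus q moves at most i and j. *)
Lemma col_tperm_row q i j : q \in col_stab lam -> (q * tperm i j)%g \in row_stab lam ->
  (q == 1%g) || (q == tperm i j).
Proof.
move=> /(@stabP _ col_of) qC /(@stabP _ row_of) qtR.
have fix_q k : k != i -> k != j -> q k = k.
  move=> ki kj; pose k' := (q^-1)%g k; have qk' : q k' = k by rewrite permKV.
  suff kk' : k = k' by rewrite {1}kk'.
  apply: (@reshape_inj n lam); last by rewrite -{1}qk' qC.
  by rewrite -(qtR k') permM qk' tpermD // eq_sym.
have [qi|qi] := eqVneq (q i) i.
  apply/orP; left; apply/eqP/permP => k; rewrite perm1.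
  have [->|ki] := eqVneq k i; first by [].
  have [kj|kj] := eqVneq k j; last exact: fix_q.
  have qki : q k != i by rewrite -[X in _ != X]qi (inj_eq perm_inj).
  have [//|qk] := eqVneq (q k) k.
  by apply: (@perm_inj _ q); apply: fix_q => //; rewrite -kj.
have qij : q i = j.
  have [//|qj] := eqVneq (q i) j.
  by have e := perm_inj (fix_q _ qi qj); rewrite e eqxx in qi.
have qji : q j = i.
  have [ji|ji] := eqVneq j i; first by rewrite ji qij ji.
  have qjj : q j != j by rewrite -[X in _ != X]qij (inj_eq perm_inj).
  have [//|qj'] := eqVneq (q j) i.
  by have e := perm_inj (fix_q _ qj' qjj); rewrite e eqxx in qjj.
apply/orP; right; apply/eqP/permP => k; case: tpermP => [->|->|/eqP ki /eqP kj] //.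
exact: fix_q.
Qed.

Lemma gcoef_youngmx1 : gcoef 1%g (youngmx reg) = 1.
Proof.
have := gcoef_youngmx_reg 1%g; rewrite repr_mx1 mulmx1 => ->.
rewrite (bigD1 1%g) /=; last first.
  by rewrite mulg1 (group1 (stab_group row_of)) (group1 (stab_group col_of)).
rewrite odd_perm1 big1 ?addr0 // => q /andP[/andP[qC]]; rewrite mulg1 => qR q1.
case/eqP: q1; apply/set1gP; rewrite -(stab_trivI (@reshape_inj n lam)) finset.in_setI.
by rewrite qR.
Qed.

Lemma gcoef_youngmx_tperm i j : gcoef 1%g (youngmx reg *m reg (tperm i j))
  = (row_of i == row_of j)%:R - (col_of i == col_of j)%:R + (i == j)%:R.
Proof.
have [<-|ij] := eqVneq i j.
  by rewrite tperm1 repr_mx1 mulmx1 gcoef_youngmx1 !eqxx subrr add0r.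
rewrite gcoef_youngmx_reg big_mkcondr big_mkcond /= (bigD1 1%g) //=.
rewrite (bigD1 (tperm i j)) /=; last first.
  by apply: contraNneq ij => /(congr1 (fun p : 'S_n => p i)); rewrite tpermL perm1 => ->.
rewrite (group1 (stab_group col_of)) mul1g -/(stab row_of) -/(stab col_of).
rewrite !(tperm_stab row_of) (tperm_stab col_of) tperm2 (group1 (stab_group row_of)).
rewrite odd_perm1 odd_tperm ij big1 => [|q /andP[q1 qt]].
  by rewrite !addr0; case: eqP; case: eqP; rewrite ?addr0 ?subr0 ?add0r ?sub0r.
case: ifP => // qC; case: ifP => // qR.
by have := col_tperm_row qC qR; rewrite (negPf q1) (negPf qt).
Qed.

(** The scalar is computed by comparing the coefficients of 1 after the action
    on the Young symmetrizer. Up to the number of points, it is twice the sum of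
    the contents, in the form of the number of ordered pairs of boxes in a common
    row minus the number of those in a common column. *)
Lemma tperm_sum_specht : tperm_sum rho =
  (\sum_i \sum_j ((row_of i == row_of j)%:R - (col_of i == col_of j)%:R
     + (i == j)%:R))%:M.
Proof.
have [a aE] := specht_schur (tperm_sum_central rho).
rewrite aE; congr (_%:M).
have := congr1 (mulmx^~ U) (congr1 (mulmx u0) aE).
rewrite -mulmxA (tperm_sum_intertwines specht_basis_intertwines) mulmxA.
rewrite specht_genE mul_mx_scalar -scalemxAl specht_genE young_symmetrizerE.
rewrite -gring_row_mul -linearZ => /(congr1 (fun v : 'rV__ => v 0 (gring_index Sn 1%g))).
rewrite !gring_rowE gcoefZ gcoef_youngmx1 mulr1 => <-.
rewrite mulmx_sumr gcoef_bigsum; apply: eq_bigr => i _.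
by rewrite mulmx_sumr gcoef_bigsum; apply: eq_bigr => j _; apply: gcoef_youngmx_tperm.
Qed.

End Specht.

(** * Adding a box *)
Lemma sum_lift_max (V : nmodType) n (f : 'I_n.+1 -> V) :
  \sum_i f i = \sum_i f (lift ord_max i) + f ord_max.
Proof.
rewrite big_ord_recr; congr (_ + _); apply: eq_bigr => i _; congr f.
by apply: val_inj; rewrite /= /bump leqNgt ltn_ord.
Qed.

Section AddBox.
Variables (n : nat) (lam : diagram n) (nu : diagram n.+1) (b : nat * nat).
Hypothesis lam_nu : adds_box lam nu b.

Lemma diagram_nonincr m (mu : diagram m) i j :
  (i <= j)%N -> (nth 0 mu j <= nth 0 mu i)%N.
Proof.
move=> ij; have [sj|js] := leqP (size mu) j; first by rewrite nth_default.
have geq_tr : transitive geq by move=> x y z xy yz; apply: leq_trans yz xy.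
have := sorted_leq_nth geq_tr leqnn 0%N (rows_sorted mu).
by apply; rewrite ?inE // (leq_ltn_trans ij).
Qed.

(** If this row of lam were shorter, the box of nu just before b would be
    missing in lam. *)
Lemma box_row : nth 0%N lam b.1 = b.2.
Proof.
have [bl nuE] := lam_nu; apply/eqP; rewrite eqn_leq leqNgt bl /=.
have := nuE b; rewrite eqxx orbT; case: b bl nuE => i [//|j] /= bl nuE ji.
have := nuE (i, j); rewrite /in_diagram /= in ji *.
rewrite (ltn_trans (ltnSn j) ji) => /esym/orP[//|/eqP[/esym/eqP]].
by rewrite (gtn_eqF (ltnSn j)).
Qed.

Lemma box_col i : (b.2 < nth 0 lam i)%N = (i < b.1)%N.
Proof.
have [bl nuE] := lam_nu; have := nuE b; rewrite eqxx orbT /in_diagram => bnu.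
apply/idP/idP => [bi|ib].
  rewrite ltnNge; apply: contra bl => bi'; rewrite /in_diagram.
  exact: leq_trans bi (diagram_nonincr _ bi').
have := nuE (i, b.2); rewrite /in_diagram /=.
rewrite (leq_trans bnu (diagram_nonincr nu (ltnW ib))) => /esym/orP[//|/eqP eb].
by have := congr1 fst eb => /= ib1; rewrite ib1 ltnn in ib.
Qed.

Lemma count_row : (\sum_(k < n) (reshape_index lam k == b.1))%N = b.2.
Proof.
rewrite -[RHS]box_row -[RHS]minnn.
rewrite -(card_row_cut (@reshape_lt n lam) (@reshape_inj n lam) (@reshape_surj n lam)).
rewrite -sum1_card [RHS]big_mkcond; apply: eq_bigr => k _ /=; rewrite inE.
by case: eqP => // <-; rewrite reshape_lt.
Qed.

Lemma count_col : (\sum_(k < n) (reshape_offset lam k == b.2))%N = b.1.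
Proof.
pose m := (b.1 + size lam)%N.
transitivity #|[pred k : 'I_n |
  (reshape_offset lam k == b.2) && (reshape_index lam k < m)%N]|.
  rewrite -sum1_card [RHS]big_mkcond; apply: eq_bigr => k _ /=; rewrite inE.
  rewrite (leq_trans (reshape_indexP (diagram_ltn lam k)) (leq_addl _ _)) andbT.
  by case: eqP.
rewrite (card_col_cut (@reshape_lt n lam) (@reshape_inj n lam) (@reshape_surj n lam)).
rewrite (eq_count box_col) iotaD count_cat add0n.
rewrite (eq_in_count (a2 := predT)) ?count_predT ?size_iota; last first.
  by move=> i; rewrite mem_iota => /andP[_ ->].
rewrite (eq_in_count (a2 := pred0)) ?count_pred0 ?addn0 // => i.
by rewrite mem_iota => /andP[bi _]; rewrite ltnNge bi.
Qed.

(** Besides its own numbering row by row, nu has the numbering of lam, completed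
    by giving the last number to the added box; s compares the two. *)
Lemma box_numbering : exists s : 'S_n.+1,
  [/\ forall k : 'I_n, reshape_index nu (s (lift ord_max k)) = reshape_index lam k,
      forall k : 'I_n, reshape_offset nu (s (lift ord_max k)) = reshape_offset lam k,
      reshape_index nu (s ord_max) = b.1 & reshape_offset nu (s ord_max) = b.2].
Proof.
have [bl nuE] := lam_nu.
pose box (i : 'I_n.+1) : nat * nat := if unlift ord_max i is Some k then
  (reshape_index lam k, reshape_offset lam k) else b.
have box_in i : in_diagram nu (box i).
  rewrite nuE /box; case: unliftP => [k _|_]; last by rewrite eqxx orbT.
  by rewrite /in_diagram reshape_lt.
have box_inj : injective box.
  move=> i j; rewrite /box; case: unliftP => [k ->|->]; case: unliftP => [k' ->|->] //.
  - by case=> /reshape_inj h /h ->.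
  - by move=> e; case/negP: bl; rewrite -e /in_diagram reshape_lt.
  - by move=> e; case/negP: bl; rewrite e /in_diagram reshape_lt.
have /boolp.choice[f fE] : forall i, exists k : 'I_n.+1,
    reshape_index nu k = (box i).1 /\ reshape_offset nu k = (box i).2.
  by move=> i; have [k rk ck] := reshape_surj (box_in i); exists k.
have f_inj : injective f.
  move=> i j e; apply: box_inj; have [ri ci] := fE i; have [rj cj] := fE j.
  by rewrite [box i]surjective_pairing -ri -ci e rj cj -surjective_pairing.
have boxl k : box (lift ord_max k) = (reshape_index lam k, reshape_offset lam k).
  by rewrite /box liftK.
have boxm : box ord_max = b by rewrite /box unlift_none.
exists (perm f_inj); split=> [k|k||]; rewrite permE.
- by have [-> _] := fE (lift ord_max k); rewrite boxl.
- by have [_ ->] := fE (lift ord_max k); rewrite boxl.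
- by have [-> _] := fE ord_max; rewrite boxm.
- by have [_ ->] := fE ord_max; rewrite boxm.
Qed.

End AddBox.

Definition jucys_murphy (F : numFieldType) n e
    (r : mx_representation F [set: 'S_n.+1] e) : 'M[F]_e :=
  \sum_(i < n) r (tperm ord_max (lift ord_max i)).

Lemma Sembed_tperm n (i j : 'I_n) :
  Sembed (tperm i j) = tperm (lift ord_max i) (lift ord_max j).
Proof.
apply/permP => k; case: (unliftP ord_max k) => [k' ->|->].
  by rewrite Sembed_lift (inj_tperm _ _ _ (@lift_inj _ _)).
by rewrite Sembed_max tpermD // eq_sym neq_lift.
Qed.

Lemma tperm_sum_res (R : realType) n e (r : mx_representation R[i] [set: 'S_n.+1] e) :
  tperm_sum r = tperm_sum (res_repr r) + 2%:R *: jucys_murphy r + 1%:M.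
Proof.
rewrite /tperm_sum sum_lift_max sum_lift_max tperm1 repr_mx1.
under eq_bigr => i _ do rewrite sum_lift_max.
rewrite big_split /= addrA; congr (_ + _).
rewrite scaler_nat mulr2n addrA; congr (_ + _); congr (_ + _).
  by apply: eq_bigr => i _; apply: eq_bigr => j _; rewrite /= Sembed_tperm.
by apply: eq_bigr => i _; rewrite tpermC.
Qed.

(** * The copy of pi^lam in pi^nu *)
Section RegularHom.
Variables (F : numFieldType) (gT : finGroupType) (e : nat).
Variables (r : mx_representation F [set: gT] e) (w : 'rV[F]_e).

Definition regular_hom : 'M[F]_(#|[set: gT]|, e) := \matrix_i (w *m r (enum_val i)).

Lemma regular_hom_intertwines : intertwines (regular_repr F [set: gT]) r regular_hom.
Proof.
move=> x; apply/row_matrixP => i; rewrite !row_mul !rowK -rowE rowK.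
by rewrite gring_indexK ?inE // -mulmxA -reprM.
Qed.

Lemma row_regular_hom1 : row (gring_index [set: gT] 1%g) regular_hom = w.
Proof. by rewrite rowK gring_indexK ?group1 // repr_mx1 mulmx1. Qed.

End RegularHom.

Section Hom.
Variables (R : realType) (n : nat) (lam : diagram n) (nu : diagram n.+1).
Variable b : nat * nat.
Hypothesis lam_nu : adds_box lam nu b.
Local Notation C := R[i].
Local Notation rlam := (specht R lam).
Local Notation rnu := (specht R nu).
Local Notation reg1 := (regular_repr C [set: 'S_n.+1]).
Local Notation reg0 := (regular_repr C [set: 'S_n]).

Lemma res_intertwines e f (r1 : mx_representation C [set: 'S_n.+1] e)
    (r2 : mx_representation C [set: 'S_n.+1] f) S :
  intertwines r1 r2 S -> intertwines (res_repr r1) (res_repr r2) S.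
Proof. by move=> hS y; apply: hS. Qed.

Lemma youngmx_intertwines e f (r1 : mx_representation C [set: 'S_n] e)
    (r2 : mx_representation C [set: 'S_n] f) S :
  intertwines r1 r2 S -> youngmx lam r1 *m S = S *m youngmx lam r2.
Proof.
move=> hS; rewrite /youngmx -mulmxA (intertwines_signed_sum _ _ hS).
by rewrite [LHS]mulmxA (intertwines_signed_sum _ _ hS) mulmxA.
Qed.

Lemma Sembed_group_set (A : {group 'S_n}) : group_set [set Sembed y | y in A].
Proof.
apply/group_setP; split; first by rewrite -(Sembed1 n) imset_f ?group1.
move=> _ _ /imsetP[x xA ->] /imsetP[y yA ->].
by rewrite -SembedM imset_f ?groupM.
Qed.
Definition Sembed_group A := Group (Sembed_group_set A).

Lemma signed_sum_res e (r : mx_representation C [set: 'S_n.+1] e) s (A : {set 'S_n}) :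
  signed_sum (res_repr r) s A = signed_sum r s [set Sembed y | y in A].
Proof.
rewrite /signed_sum big_imset /= => [|x y _ _]; last exact: Sembed_inj.
by apply: eq_bigr => y _; rewrite odd_Sembed.
Qed.

Lemma stab_comp m (f : 'I_m -> nat) (s : 'S_m) : (stab (f \o s) :^ s)%g = stab f.
Proof.
apply/setP => p; rewrite mem_conjg; apply/stabP/stabP => h k.
  by have := h ((s^-1)%g k); rewrite conjgE invgK /= !permM !permKV.
by rewrite conjgE invgK /= !permM permKV h.
Qed.

(** The vector is c_nu s^-1 C_lam, where s renumbers the boxes so that the row
    and column groups of lam become subgroups of those of nu; the product
    c_nu s^-1 C_lam R_lam C_lam is then covered by signed_sums_neq0. *)
Lemma young_nonzero_vector :
  exists w : 'rV[C]_(dim_diagram R nu), w *m youngmx lam (res_repr rnu) != 0.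
Proof.
have [s [rs cs rm cm]] := box_numbering lam_nu.
pose r' := (fun k : 'I_n.+1 => reshape_index nu k) \o s.
pose c' := (fun k : 'I_n.+1 => reshape_offset nu k) \o s.
pose r0 := fun k : 'I_n => reshape_index lam k.
pose c0 := fun k : 'I_n => reshape_offset lam k.
have sub f f0 m : (forall k, f (lift ord_max k) = f0 k) -> f ord_max = m ->
    Sembed_group (stab_group f0) \subset stab_group f.
  move=> fE fm; apply/fintype.subsetP => _ /imsetP[p /stabP hp ->].
  apply/stabP => k; case: (unliftP ord_max k) => [k' ->|->].
    by rewrite Sembed_lift !fE.
  by rewrite Sembed_max.
have trivI : stab_group r' :&: stab_group c' = 1%g.
  apply: stab_trivI => k k' rk ck; apply: (@perm_inj _ s).
  exact: reshape_inj rk ck.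
have := @signed_sums_neq0 C n.+1 _ _ _ _ (sub r' r0 _ rs rm) (sub c' c0 _ cs cm) trivI.
set P := signed_sum _ _ _; set Q := signed_sum _ _ _; set D := signed_sum _ _ _.
set R0 := signed_sum _ _ _ => nz.
have conjPQ : P *m Q *m reg1 s = reg1 s *m youngmx nu reg1.
  rewrite /youngmx -mulmxA -signed_sum_conj stab_comp mulmxA -signed_sum_conj stab_comp.
  by rewrite mulmxA.
have [w wE] : exists w : 'rV[C]_(dim_diagram R nu),
    w *m specht_basis R nu = young_symmetrizer R nu *m (reg1 s^-1%g *m D).
  apply: sub_spechtP; exists (reg1 s^-1%g *m D) => //.
  by rewrite envelop_mxM ?envelop_mx_id ?inE // signed_sum_group_ring.
exists w; apply: contraNneq nz => w0.
have := congr1 (mulmx^~ (specht_basis R nu)) w0.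
rewrite mul0mx -mulmxA.
rewrite (youngmx_intertwines (res_intertwines (@specht_basis_intertwines _ _ nu))).
rewrite mulmxA wE young_symmetrizerE {2}/youngmx !signed_sum_res -/D -/R0.
rewrite -!gring_row_mul => /gring_row_eq0 Z0.
have PQE : P *m Q = reg1 s *m youngmx nu reg1 *m reg1 s^-1%g.
  by rewrite -conjPQ -[RHS]mulmxA reprVK mulmx1.
rewrite PQE -!(mulmxA (reg1 s)) -[_ *m D *m R0 *m D]mulmxA -[_ *m _ *m D]mulmxA.
rewrite Z0 ?mulmx0 //.
by rewrite !envelop_mxM ?envelop_mx_id ?inE ?signed_sum_group_ring // youngmx_group_ring.
Qed.

(** The vector w defines a homomorphism x |-> w x from the group algebra of S(n)
    to pi^nu, which is not zero on the Young symmetrizer of lam. *)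
Lemma specht_hom_neq0 : exists2 S : 'M[C]_(dim_diagram R lam, dim_diagram R nu),
  S != 0 & intertwines rlam (res_repr rnu) S.
Proof.
have [w w_neq0] := young_nonzero_vector; set r2 := res_repr rnu in w_neq0 *.
set K := regular_hom r2 w; have hK := regular_hom_intertwines r2 w.
exists (specht_basis R lam *m K); last first.
  exact: intertwines_mul (@specht_basis_intertwines R n lam) hK.
apply: contraNneq w_neq0 => S0.
have := congr1 (mulmx (specht_gen R lam)) S0.
rewrite mulmx0 mulmxA specht_genE young_symmetrizerE -[youngmx lam reg0]mul1mx.
rewrite gring_row_mul -mulmxA (youngmx_intertwines hK) mulmxA => <-.
by rewrite /gring_row -row_mul mul1mx row_regular_hom1.
Qed.

(** With the numbering of the boxes that extends the one of lam, the new terms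
    are the pairs formed by the added box and a box in its row or column; their
    numbers differ by the content. *)
Lemma sum_eq_content : \sum_(i < n.+1) \sum_(j < n.+1)
    ((reshape_index nu i == reshape_index nu j)%:R
     - (reshape_offset nu i == reshape_offset nu j)%:R + (i == j)%:R)
  = \sum_(i < n) \sum_(j < n)
    ((reshape_index lam i == reshape_index lam j)%:R
     - (reshape_offset lam i == reshape_offset lam j)%:R + (i == j)%:R)
   + 2%:R * (content b)%:~R + 1 :> C.
Proof.
have [s [rs cs rm cm]] := box_numbering lam_nu.
rewrite (reindex_inj (@perm_inj _ s)) /=.
under eq_bigr => i _ do rewrite (reindex_inj (@perm_inj _ s)) /=.
rewrite sum_lift_max sum_lift_max /= !rm !cm !eqxx subrr add0r addrA; congr (_ + 1).
under eq_bigr => i _ do rewrite sum_lift_max.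
rewrite big_split /= -addrA; congr (_ + _).
  apply: eq_bigr => i _; apply: eq_bigr => j _.
  by rewrite !rs !cs (inj_eq perm_inj) (inj_eq lift_inj).
have side (k : 'I_n) : (s (lift ord_max k) == s ord_max) = false.
  by rewrite (inj_eq perm_inj) eq_sym (negPf (neq_lift _ _)).
transitivity (2%:R * \sum_(k < n) ((reshape_index lam k == b.1)%:R
   - (reshape_offset lam k == b.2)%:R) : C).
  rewrite mulr_natl mulr2n; congr (_ + _); apply: eq_bigr => k _.
    by rewrite rs cs rm cm side addr0.
  by rewrite rs cs (eq_sym (s _)) side addr0 (eq_sym b.1) (eq_sym b.2).
congr (_ * _); rewrite sumrB -!natr_sum (count_row lam_nu) (count_col lam_nu).
by rewrite /content intrB.
Qed.

(** By tperm_sum_res, rho_nu(J) is expressed through central sums of S(n+1) and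
    of S(n), which act by known scalars on the image of pi^lam. *)
Lemma jucys_murphy_content T : intertwines (res_repr rnu) rlam T ->
  jucys_murphy rnu *m T = (content b)%:~R *: T.
Proof.
move=> hT; have two_neq0 : 2%:R != 0 :> C by rewrite pnatr_eq0.
apply: (scalerI two_neq0); have := congr1 (mulmx^~ T) (tperm_sum_res rnu).
rewrite !mulmxDl (tperm_sum_intertwines hT) !tperm_sum_specht sum_eq_content.
rewrite mul_mx_scalar mul_scalar_mx mul1mx -scalemxAl.
move: (\sum_i _) => x; rewrite [(x + _ + 1) *: T]scalerDl scale1r.
by move=> /GRing.addIr; rewrite [(x + _) *: T]scalerDl scalerA => /GRing.addrI <-.
Qed.

End Hom.

(** * Matrix coefficients and the spaces H(lam) *)
Lemma form_twist (F : fieldType) d (A A' B A1 : 'M[F]_d) :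
  A' *m A = 1%:M -> A *m B *m A1 = B -> A' *m B = B *m A1.
Proof. by move=> A'A {1}<-; rewrite !mulmxA A'A mul1mx. Qed.

Lemma trace_cycle (F : fieldType) d (A B X H : 'M[F]_d) :
  \tr (A *m (B *m X *m H)) = \tr (X *m (H *m A *m B)).
Proof. by rewrite [RHS]mxtrace_mulC mulmxA [LHS]mxtrace_mulC !mulmxA. Qed.

Lemma trace_twist (F : fieldType) d (X B V G1 G2 G2' : 'M[F]_d) :
  G2' *m B = B *m G2^T ->
  \tr (X *m (B *m (G1^T *m V *m G2)^T)) = \tr (G1 *m X *m G2' *m (B *m V^T)).
Proof.
move=> e; have -> : G1 *m X *m G2' *m (B *m V^T) = G1 *m (X *m (B *m (G2^T *m V^T))).
  by rewrite -!mulmxA (mulmxA G2') e !mulmxA.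
by rewrite !trmx_mul trmxK [RHS]mxtrace_mulC !mulmxA.
Qed.

Section Coefficients.
Variables (R : realType) (n : nat) (lam : diagram n).
Local Notation C := R[i].
Local Notation rho := (specht R lam).
Local Notation d := (dim_diagram R lam).

Definition coef_fun (M : 'M[C]_d) : L2S R n := [ffun x : 'S_n => \tr (rho x *m M)].

(** The tensor u (x) w becomes the matrix u^T w. *)
Definition tens_mx (v : 'rV[C]_(d * d)) : 'M[C]_d :=
  \matrix_(k, l) v 0 (mxtens_index (k, l)).

Lemma tens_mxM (v : 'rV[C]_(d * d)) (A B : 'M[C]_d) :
  tens_mx (v *m tensmx A B) = A^T *m tens_mx v *m B.
Proof.
apply/matrixP => k l; rewrite !mxE.
rewrite (reindex (@mxtens_index d d)) /=; last first.
  by exists (@mxtens_unindex d d) => i _; rewrite ?mxtens_indexK ?mxtens_unindexK.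
under [RHS]eq_bigr => j _ do rewrite mxE mulr_suml.
rewrite exchange_big pair_big /=; apply: eq_bigr => -[i j] _ /=.
by rewrite tensmxE !mxE mulrCA mulrA.
Qed.

(** On u (x) w this is the function x |-> u rho(x) B w^T. *)
Definition tens_coef (B : 'M[C]_d) (v : 'rV[C]_(d * d)) : L2S R n :=
  coef_fun (B *m (tens_mx v)^T).

Lemma tens_coef_is_linear B : linear (tens_coef B).
Proof.
move=> a u v; apply/ffunP => x; rewrite !ffunE.
have -> : tens_mx (a *: u + v) = a *: tens_mx u + tens_mx v.
  by apply/matrixP => k l; rewrite !mxE.
by rewrite linearP /= mulmxDr mulmxDr -!scalemxAr linearP.
Qed.
HB.instance Definition _ B :=
  GRing.isLinear.Build C 'rV[C]_(d * d) (L2S R n) _ (tens_coef B) (tens_coef_is_linear B).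

Lemma tens_mx_surj M : exists v, tens_mx v = M.
Proof.
exists (\row_k M (mxtens_unindex k).1 (mxtens_unindex k).2).
by apply/matrixP => k l; rewrite !mxE mxtens_indexK.
Qed.

Lemma tens_mx_inj : injective tens_mx.
Proof.
move=> u v e; apply/rowP => k; case: (mxtens_indexP k) => i j.
by have /matrixP/(_ i j) := e; rewrite !mxE.
Qed.

Lemma coef_fun_inj : injective coef_fun.
Proof.
move=> M N e; have k_neq0 : #|'S_n|%:R / d%:R != 0 :> C.
  rewrite mulf_neq0 ?invr_eq0 ?pnatr_eq0 -?lt0n ?dim_diagram_gt0 //.
  by rewrite (cardD1 1%g).
apply: (scalerI k_neq0).
rewrite -!(schur_orthogonality _ (dim_diagram_gt0 R lam) (@specht_schur R n lam)).
by apply: eq_bigr => x _; have /ffunP/(_ x) := e; rewrite !ffunE => ->.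
Qed.

Lemma linear_at_tens (Phi : {linear 'rV[C]_(d * d) -> L2S R n}) (x : 'S_n) w :
  Phi w x = \tr ((\matrix_(k, l) Phi (delta_mx 0 (mxtens_index (k, l))) x)
    *m (tens_mx w)^T).
Proof.
rewrite {1}[w]row_sum_delta linear_sum sum_ffunE.
rewrite (reindex (@mxtens_index d d)) /=; last first.
  by exists (@mxtens_unindex d d) => i _; rewrite ?mxtens_indexK ?mxtens_unindexK.
rewrite /mxtrace; under [RHS]eq_bigr => k _ do rewrite mxE.
rewrite pair_bigA; apply: eq_bigr => -[k l] _ /=.
by rewrite linearZ ffunE !mxE mulrC.
Qed.

(** Evaluating at 1 the images under the pairs (x, 1) shows that the values of
    an equivariant map are matrix coefficients. Conversely,
    x |-> u rho(x) B w^T is equivariant in u and w if B is an invariant bilinear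
    form. *)
Lemma HcompP f : Hcomp lam f <-> exists M, f = coef_fun M.
Proof.
split=> [[Phi [_ Phi_eq [v ->]]]|[M ->]].
  pose L := \matrix_(k, l) Phi (delta_mx 0 (mxtens_index (k, l))) 1%g : 'M[C]_d.
  exists (L *m (tens_mx v)^T); apply/ffunP => x; rewrite ffunE.
  have := congr1 (fun f : L2S R n => f 1%g) (Phi_eq (x, 1%g) v).
  rewrite [RHS]ffunE invg1 !mulg1 => <-; rewrite linear_at_tens -/L tens_mxM.
  by rewrite repr_mx1 mulmx1 trmx_mul trmxK mulmxA mxtrace_mulC mulmxA.
have [B uB invB] := specht_selfdual R lam.
exists (tens_coef B); split=> [u v /coef_fun_inj|g v|].
- by move=> /(can_inj (mulKmx uB))/trmx_inj/tens_mx_inj.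
- have invB' : rho g.2^-1%g *m B = B *m (rho g.2)^T.
    exact: form_twist (reprKV _ _) (invB _).
  apply/ffunP => x; rewrite [LHS]ffunE [RHS]ffunE [RHS]ffunE tens_mxM.
  by rewrite !reprM; apply: trace_twist.
- have [v vE] := tens_mx_surj (invmx B *m M)^T; exists v.
  by rewrite -[RHS]/(tens_coef B v) /tens_coef vE trmxK mulKVmx.
Qed.

Lemma Hcomp_coef (M : 'M[C]_d) : Hcomp lam (coef_fun M).
Proof. by apply/HcompP; exists M. Qed.

Lemma Hcomp_sub (f h : L2S R n) : Hcomp lam f -> Hcomp lam h -> Hcomp lam (f - h).
Proof.
move=> /HcompP[M ->] /HcompP[N ->]; apply/HcompP; exists (M - N).
by apply/ffunP => x; rewrite !ffunE mulmxBr linearB.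
Qed.

(** The Specht module is unitary for a suitable hermitian form, and taking
    adjoints then exchanges x and x^-1. *)
Lemma conj_trace_specht N : exists N', forall x,
  (\tr (rho x *m N))^* = \tr (rho x^-1%g *m N').
Proof.
have [H uH invH] := specht_hermitian R lam.
exists (H *m adjmx N *m invmx H) => x.
have -> : (\tr (rho x *m N))^* = \tr (adjmx N *m adjmx (rho x)).
  by rewrite -adjmxM /adjmx trace_map_mx mxtrace_tr.
have -> : adjmx (rho x) = invmx H *m rho x^-1%g *m H.
  by rewrite -mulmxA (form_twist (reprKV _ _) (invH x)) mulKmx.
exact: trace_cycle.
Qed.

Definition fourier (h : L2S R n) : 'M[C]_d := \sum_x h x *: rho x^-1%g.

(** In particular the scalar products of h with H(lam) only depend on the
    Fourier transform of h at lam. *)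
Lemma l2dot_coef_fun N : exists N',
  (forall x, (\tr (rho x *m N))^* = \tr (rho x^-1%g *m N'))
  /\ forall h, l2dot h (coef_fun N) = n`!%:R^-1 * \tr (fourier h *m N').
Proof.
have [N' N'E] := conj_trace_specht N; exists N'; split=> // h; congr (_ * _).
rewrite mulmx_suml raddf_sum; apply: eq_bigr => x _.
by rewrite -scalemxAl -[RHS]/(\tr _) mxtraceZ ffunE N'E.
Qed.

Definition proj_coef (h : L2S R n) : L2S R n :=
  coef_fun ((d%:R / n`!%:R) *: fourier h).

Lemma fourier_coef_fun M : fourier (coef_fun M) = (n`!%:R / d%:R) *: M.
Proof.
have := schur_orthogonality M (dim_diagram_gt0 R lam) (@specht_schur R n lam).
rewrite card_Sn => <-.
by apply: eq_bigr => x _; rewrite ffunE.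
Qed.

(** By orthogonality of matrix coefficients h and its projection have the same
    Fourier transform at lam. *)
Lemma proj_coef_orth h (f : L2S R n) : Hcomp lam f -> l2dot (h - proj_coef h) f = 0.
Proof.
case/HcompP=> N ->; have [N' [_ ->]] := l2dot_coef_fun N.
suff -> : fourier (h - proj_coef h) = 0 by rewrite mul0mx linear0 mulr0.
have nf : n`!%:R != 0 :> C by rewrite pnatr_eq0 -lt0n fact_gt0.
have nd : d%:R != 0 :> C by rewrite pnatr_eq0 -lt0n dim_diagram_gt0.
transitivity (fourier h - fourier (proj_coef h)).
  rewrite /fourier -sumrB; apply: eq_bigr => x _.
  by rewrite !ffunE scalerBl.
rewrite fourier_coef_fun scalerA mulrA divfK // divff // scale1r.
by rewrite subrr.
Qed.

End Coefficients.

(** * The transition function *)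
Lemma orthproj_eq (F : numClosedFieldType) (V : lmodType F) (dt : {dot V for Num.conj})
    (W : set V) (x y : V) :
    (forall u v, W u -> W v -> W (u - v)) ->
    W y -> (forall w, W w -> dt (x - y) w = 0) ->
  xget 0 [set y | W y /\ forall w, W w -> dt (x - y) w = 0]%classic = y.
Proof.
move=> Wsub Wy orth_y; apply: xget_unique => // y' [Wy' orth_y'].
apply/eqP; rewrite -subr_eq0 -(dnorm_eq0 dt); apply/eqP.
have Wd : W (y' - y) by apply: Wsub.
have {1}-> : y' - y = (x - y) - (x - y') by rewrite opprB [RHS]addrC addrA subrK.
by rewrite linearBl [X in X - _](orth_y _ Wd) [X in _ - X](orth_y' _ Wd) subr0.
Qed.

Lemma trace_translate (F : numFieldType) (gT : finGroupType) m
    (r : mx_representation F [set: gT] m) x g1 g2 k A :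
  \tr (r x *m (k *: (r g2^-1%g *m A *m r g1)))
  = \tr (r (g1 * x * g2^-1)%g *m (k *: A)).
Proof.
rewrite -!scalemxAr !mxtraceZ; congr (_ * _).
by rewrite !reprM mulmxA mxtrace_mulC !mulmxA.
Qed.

Lemma trace_compress (F : fieldType) m p (S : 'M[F]_(m, p)) (T : 'M_(p, m)) M X Y :
  S *m T = 1%:M -> X *m T = T *m Y -> \tr (X *m (T *m M *m S)) = \tr (Y *m M).
Proof.
by move=> ST XT; rewrite !mulmxA mxtrace_mulC XT !mulmxA ST mul1mx.
Qed.

Lemma l2dotZ (R : realType) n (k : R[i]) (f : L2S R n) :
  l2dot (k *: f) (k *: f) = `|k| ^+ 2 * l2dot f f.
Proof.
rewrite /l2dot mulrCA; congr (_ * _); rewrite mulr_sumr; apply: eq_bigr => x _.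
by rewrite !ffunE rmorphM normCK /= mulrACA.
Qed.

Section Transition.
Variables (R : realType) (n : nat) (lam : diagram n) (nu : diagram n.+1).
Local Notation C := R[i].
Local Notation rlam := (specht R lam).
Local Notation rnu := (specht R nu).
Local Notation d := (dim_diagram R lam).
Local Notation e := (dim_diagram R nu).

(** The Fourier transform at nu of f, extended by zero to S(n+1). *)
Definition res_fourier (f : L2S R n) : 'M[C]_e := \sum_y f y *: rnu (Sembed y^-1%g).

(** A multiple of the projection to H(nu) of f extended by zero. *)
Definition branch (k : C) (f : L2S R n) : L2S R n.+1 :=
  coef_fun (k *: res_fourier f).

Lemma branch_is_linear k : linear (branch k).
Proof.
move=> a f h; have -> : branch k (a *: f + h)
    = coef_fun (a *: (k *: res_fourier f) + k *: res_fourier h).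
  rewrite /branch; congr coef_fun; rewrite /res_fourier scalerA (mulrC a) -scalerA.
  rewrite -scalerDr; congr (_ *: _); rewrite scaler_sumr -big_split.
  by apply: eq_bigr => y _; rewrite /= ffunE ffunE scalerA -scalerDl.
apply/ffunP => x; rewrite [LHS]ffunE [RHS]ffunE ffunE [branch k f x]ffunE.
by rewrite [branch k h x]ffunE mulmxDr mxtraceD -scalemxAr mxtraceZ.
Qed.
HB.instance Definition _ k :=
  GRing.isLinear.Build C (L2S R n) (L2S R n.+1) _ (branch k) (branch_is_linear k).

Lemma branchE k f : branch k f = k *: coef_fun (res_fourier f).
Proof. by apply/ffunP => x; rewrite !ffunE -scalemxAr mxtraceZ. Qed.

Lemma branch_equivariant k f (g : 'S_n * 'S_n) :
  branch k (Reg g f) = Reg (Sembed g.1, Sembed g.2) (branch k f).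
Proof.
apply/ffunP => x; rewrite [RHS]ffunE [LHS]ffunE [RHS]ffunE [(_, _).1]/= [(_, _).2]/=.
have -> : res_fourier (Reg g f)
    = rnu (Sembed g.2)^-1%g *m res_fourier f *m rnu (Sembed g.1).
  rewrite /res_fourier mulmx_sumr mulmx_suml.
  rewrite [RHS](reindex_inj (mulgI g.1)) [RHS](reindex_inj (mulIg g.2^-1%g)) /=.
  apply: eq_bigr => y _; rewrite ffunE -scalemxAr -scalemxAl mulgA; congr (_ *: _).
  by rewrite -!reprM -!SembedV -!SembedM !invMg invgK !mulgA mulVg mul1g mulgKV.
exact: trace_translate.
Qed.

Section Box.
Variable b : nat * nat.
Hypothesis lam_nu : adds_box lam nu b.

(** The maps S and T are the embedding of pi^lam in pi^nu and the projection
    back, for modules of row vectors. *)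
Lemma res_fourier_coef_fun : exists S T,
  [/\ S *m T = 1%:M, intertwines rlam (res_repr rnu) S,
      intertwines (res_repr rnu) rlam T
    & forall M, res_fourier (coef_fun M) = (n`!%:R / d%:R) *: (T *m M *m S)].
Proof.
have [S S_neq0 hS] := specht_hom_neq0 R lam_nu.
have d_gt0 := dim_diagram_gt0 R lam; have sl := @specht_schur R n lam.
have [T [ST hT T_uniq]] := branching d_gt0 sl (@specht_schur R n.+1 nu) S_neq0 hS.
exists S, T; split=> // M.
have := fourier_multiplicity_one M d_gt0 sl hS ST T_uniq; rewrite card_Sn => <-.
by apply: eq_bigr => y _; rewrite ffunE.
Qed.

(** For f in H(lam), extended by zero to S(n+1), this is the ratio of the
    projections of Lz f and of f to H(nu). *)
Definition Lz_factor (z : option C) : C :=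
  match z with
  | Some w => sqrtC (n.+1%:R / (`|w| ^+ 2 + n%:R)) * (w + (content b)%:~R)
  | None => sqrtC n.+1%:R
  end.

(** The Fourier transform of the translate of f by w + J is w + rho_nu(J) applied
    to that of f, and J acts by the content on the image of T. *)
Lemma fourier_Lz z f : Hcomp lam f ->
  fourier nu (Lz z f) = Lz_factor z *: res_fourier f.
Proof.
case/HcompP=> M ->; have [S [T [_ _ hT TE]]] := res_fourier_coef_fun.
set f0 := coef_fun M.
have JT : jucys_murphy rnu *m res_fourier f0 = (content b)%:~R *: res_fourier f0.
  rewrite TE -scalemxAr 2!mulmxA (jucys_murphy_content lam_nu hT).
  by rewrite -!scalemxAl !scalerA [in LHS]mulrC.
rewrite /fourier sum_cosets.
have LzE y j : Lz z f0 (Sembed y * tperm ord_max j)%g =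
  match z with
  | Some w => (if j == ord_max then w else 1)
       * sqrtC (n.+1%:R / (`|w| ^+ 2 + n%:R)) * f0 y
  | None => if j == ord_max then sqrtC n.+1%:R * f0 y else 0
  end.
  have jE : (Sembed y * tperm ord_max j)%g ord_max = j by rewrite permM Sembed_max tpermL.
  rewrite ffunE jE; suff -> : Sproj (Sembed y * tperm ord_max j) = y by [].
  by apply: Sembed_inj; rewrite Sembed_Sproj jE -mulgA tperm2 mulg1.
have ltF (i : 'I_n) : (lift ord_max i == ord_max) = false.
  by rewrite eq_sym (negPf (neq_lift _ _)).
have JE : jucys_murphy rnu *m res_fourier f0 = \sum_y \sum_(i < n)
    f0 y *: rnu (Sembed y * tperm ord_max (lift ord_max i))^-1%g.
  rewrite mulmx_sumr; apply: eq_bigr => y _; rewrite mulmx_suml; apply: eq_bigr => i _.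
  by rewrite -scalemxAr -reprM invMg tpermV SembedV.
under eq_bigr => y _ do rewrite sum_lift_max !LzE eqxx tperm1 mulg1 -SembedV.
case: z LzE => [w|] LzE /=.
  rewrite -scalerA scalerDl -JT JE scalerDr !scaler_sumr big_split /= addrC.
  congr (_ + _); apply: eq_bigr => y _; first by rewrite !scalerA (mulrC w).
  by rewrite scaler_sumr; apply: eq_bigr => i _; rewrite LzE ltF mul1r scalerA.
rewrite scaler_sumr; apply: eq_bigr => y _.
by rewrite big1 ?add0r ?scalerA // => i _; rewrite LzE ltF scale0r.
Qed.

(** Since S rho_nu(y) T = rho_lam(y) for y in S(n), the coefficient function
    restricts to a multiple of f there, and its scalar product with itself is
    the one of this restriction with f, up to a constant. *)
Lemma l2dot_res_fourier f : Hcomp lam f ->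
  l2dot (coef_fun (res_fourier f)) (coef_fun (res_fourier f))
  = n`!%:R ^+ 2 / (d%:R * e%:R) * l2dot f f.
Proof.
case/HcompP=> M ->; have [S [T [ST hS hT TE]]] := res_fourier_coef_fun.
set f0 := coef_fun M; set G := res_fourier f0.
have coefG y : \tr (rnu (Sembed y) *m G) = n`!%:R / d%:R * f0 y.
  rewrite /G TE -scalemxAr mxtraceZ ffunE; congr (_ * _).
  exact: trace_compress ST (hT y).
have [N' [N'E ->]] := l2dot_coef_fun G.
have nf m : m`!%:R != 0 :> C by rewrite pnatr_eq0 -lt0n fact_gt0.
have trG : \tr (G *m N') = n`!%:R / d%:R * (n`!%:R * l2dot f0 f0).
  rewrite {1}/G /res_fourier mulmx_suml raddf_sum /l2dot mulVKf // mulr_sumr.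
  apply: eq_bigr => y _; rewrite -[LHS]/(\tr _) -scalemxAl mxtraceZ SembedV -N'E coefG.
  by rewrite rmorphM /= geC0_conj ?divr_ge0 ?ler0n // mulrCA.
rewrite fourier_coef_fun -scalemxAl mxtraceZ trG.
have nd m (mu : diagram m) : (dim_diagram R mu)%:R != 0 :> C.
  by rewrite pnatr_eq0 -lt0n dim_diagram_gt0.
move: (nd _ lam) (nd _ nu) (nf n) (nf n.+1); move: (l2dot _ _) => q.
move: (d%:R) (e%:R) (n`!%:R) (n.+1`!%:R) => a c u v a0 c0 u0 v0.
by field; rewrite c0 a0 v0.
Qed.

(** The constant is chosen according to l2dot_res_fourier. *)
Lemma branch_isometry : equivariant_isometry lam nu
  (branch (sqrtC (d%:R * e%:R) / n`!%:R)).
Proof.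
have nf : n`!%:R != 0 :> C by rewrite pnatr_eq0 -lt0n fact_gt0.
have de_neq0 : d%:R * e%:R != 0 :> C.
  by rewrite mulf_neq0 ?pnatr_eq0 -?lt0n ?dim_diagram_gt0.
move=> f Hf; split=> [||g]; [exact: Hcomp_coef| |exact: branch_equivariant].
rewrite -[X in l2dot X _]/(branch _ f) -[X in l2dot _ X]/(branch _ f) branchE.
rewrite l2dotZ l2dot_res_fourier // normrM normfV.
rewrite !ger0_norm ?sqrtC_ge0 ?mulr_ge0 ?ler0n //.
rewrite expr_div_n sqrtCK; move: de_neq0 nf.
move: (d%:R * e%:R) (n`!%:R) (l2dot f f) => a u q a0 u0.
by field; rewrite a0 u0.
Qed.

Lemma proj_Lz z f : Hcomp lam f -> proj_coef nu (Lz z f)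
  = (Lz_factor z * e%:R / (n.+1%:R * sqrtC (d%:R * e%:R)))
    *: branch (sqrtC (d%:R * e%:R) / n`!%:R) f.
Proof.
move=> Hf; rewrite branchE scalerA /proj_coef fourier_Lz // scalerA.
apply/ffunP => x; rewrite !ffunE -scalemxAr mxtraceZ; congr (_ * _).
have sq0 : sqrtC (d%:R * e%:R) != 0 :> C.
  by rewrite sqrtC_eq0 mulf_neq0 ?pnatr_eq0 -?lt0n ?dim_diagram_gt0.
have nf : n`!%:R != 0 :> C by rewrite pnatr_eq0 -lt0n fact_gt0.
rewrite factS natrM; have : n.+1%:R != 0 :> C by rewrite pnatr_eq0.
move: sq0 nf; move: (Lz_factor z) (n`!%:R) (n.+1%:R) (sqrtC _) => c v w a a0 v0 w0.
by field; rewrite a0 v0 w0.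
Qed.

Lemma Lz_factor_norm z : (0 < n)%N ->
  `|Lz_factor z * e%:R / (n.+1%:R * sqrtC (d%:R * e%:R))| ^+ 2
  = match z with
    | Some w => `|w + (content b)%:~R| ^+ 2 / (`|w| ^+ 2 + n%:R)
    | None => 1
    end * (e%:R / (n.+1%:R * d%:R)).
Proof.
move=> n_gt0; have d0 : d%:R != 0 :> C by rewrite pnatr_eq0 -lt0n dim_diagram_gt0.
have e0 : e%:R != 0 :> C by rewrite pnatr_eq0 -lt0n dim_diagram_gt0.
have N0 : n.+1%:R != 0 :> C by rewrite pnatr_eq0.
have sq0 (x : C) : 0 <= x -> `|sqrtC x| ^+ 2 = x.
  by move=> x0; rewrite ger0_norm ?sqrtC_ge0 // sqrtCK.
rewrite !normrM !normfV !normrM !normr_nat !exprMn exprVn exprMn.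
rewrite (sq0 (d%:R * e%:R)) ?mulr_ge0 ?ler0n //.
case: z => [w|] /=; last first.
  rewrite sq0 ?ler0n //; move: d0 e0 N0.
  by move: (d%:R) (e%:R) (n.+1%:R) => x y t x0 y0 t0; field; rewrite x0 y0 t0.
have t0 : `|w| ^+ 2 + n%:R != 0 :> C.
  by rewrite gt_eqF // ltr_wpDl ?exprn_ge0 ?normr_ge0 // ltr0n.
rewrite normrM exprMn sq0; last first.
  by rewrite divr_ge0 ?ler0n // addr_ge0 ?exprn_ge0 ?normr_ge0 ?ler0n.
move: d0 e0 N0 t0; move: (d%:R) (e%:R) (n.+1%:R) (`|w| ^+ 2 + n%:R) (`|_| ^+ 2).
by move=> x y u v s x0 y0 u0 v0; field; rewrite x0 y0 u0 v0.
Qed.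

End Box.
End Transition.

Section Limit.
Variables (R : realType) (z : option R[i]) (T : inductive_limit z).

Lemma PcompE n (nu : diagram n) h : (0 < n)%N ->
  Pcomp nu (lim_emb T n h) = lim_emb T n (proj_coef nu h).
Proof.
move=> n_gt0; apply: orthproj_eq.
- by move=> _ _ [f Hf <-] [g Hg <-]; exists (f - g); [exact: Hcomp_sub | rewrite linearB].
- by exists (proj_coef nu h) => //; apply: Hcomp_coef.
- by move=> _ [f Hf <-]; rewrite -linearB lim_emb_iso // proj_coef_orth.
Qed.

Lemma Hcomp_nonzero n (lam : diagram n) :
  exists2 f : L2S R n, Hcomp lam f & l2dot f f != 0.
Proof.
exists (coef_fun (1%:M : 'M_(dim_diagram R lam))); first exact: Hcomp_coef.
rewrite mulf_neq0 ?invr_eq0 ?pnatr_eq0 -?lt0n ?fact_gt0 // psumr_neq0; last first.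
  by move=> x _; rewrite mul_conjC_ge0.
apply/hasP; exists 1%g; first exact: mem_index_enum.
rewrite mul_conjC_gt0 ffunE repr_mx1 mulmx1 mxtrace1.
by rewrite pnatr_eq0 -lt0n dim_diagram_gt0.
Qed.

(** Any admissible alpha satisfies |P(nu) Lz f|^2 = |alpha|^2 |f|^2. *)
Lemma transition_value_unique n (lam : diagram n) (nu : diagram n.+1) p q :
  transition_value T lam nu p -> transition_value T lam nu q -> p = q.
Proof.
have [f Hf f_neq0] := Hcomp_nonzero lam.
have normE E (a : R[i]) : equivariant_isometry lam nu E ->
    Pcomp nu (lim_emb T n.+1 (Lz z f)) = a *: lim_emb T n.+1 (E f) ->
    lim_dot T (Pcomp nu (lim_emb T n.+1 (Lz z f))) (Pcomp nu (lim_emb T n.+1 (Lz z f)))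
    = `|a| ^+ 2 * l2dot f f.
  by move=> isoE ->; rewrite dnormZ lim_emb_iso //; have [_ -> _] := isoE f Hf.
move=> [E [a [isoE aE ->]]] [E' [a' [isoE' aE' ->]]].
apply: (mulIf f_neq0).
by rewrite -(normE E a isoE (aE f Hf)) (normE E' a' isoE' (aE' f Hf)).
Qed.

End Limit.

Theorem theorem5p5p1 (R : realType) (z : option R[i]) (T : inductive_limit z)
    (n : nat) (n_ge1 : (1 <= n)%N)
    (lam : diagram n) (nu : diagram n.+1) (b : nat * nat)
    (lam_nu : adds_box lam nu b) (p : R[i]) :
  transition_value T lam nu p <->
  p = match z with
      | Some w => `|w + (content b)%:~R| ^+ 2 / (`|w| ^+ 2 + n%:R)
      | None => 1
      end * ((dim_diagram R nu)%:R / (n.+1%:R * (dim_diagram R lam)%:R)).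
Proof.
rewrite -(Lz_factor_norm lam nu b z n_ge1); set p0 := _ ^+ 2.
have p0T : transition_value T lam nu p0.
  exists (branch nu (sqrtC ((dim_diagram R lam)%:R * (dim_diagram R nu)%:R) / n`!%:R)).
  exists (Lz_factor n b z * (dim_diagram R nu)%:R
    / (n.+1%:R * sqrtC ((dim_diagram R lam)%:R * (dim_diagram R nu)%:R))).
  split=> // [|f Hf]; first exact: branch_isometry lam_nu.
  by rewrite PcompE // (proj_Lz lam_nu) // linearZ.
by split=> [|-> //]; move/transition_value_unique; apply.
Qed.
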